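(* Let $Q$ be the source-sink quiver of type $A_{2m+1}$ (type I), with vertices $s_1,\dots,s_{2m+1}$ and arrows $a_{2i-1}:s_{2i-1}\to s_{2i}$ and $a_{2i}:s_{2i+1}\to s_{2i}$ for $1\le i\le m$. Let $V_1,\dots,V_{2m+1}$ be complex vector spaces of dimensions $d_1,\dots,d_{2m+1}$ and let $\mathcal R_d$ be the space of representations of $Q$ on them. Let $r=(r_1,\dots,r_{2m})$, $p=(p_1,\dots,p_m)$, $q=(q_1,\dots,q_{m-1})$ be integer vectors, and let $\overline{\mathcal O}_{r,p,q}$ be the closure of the set $\mathcal O_{r,p,q}$ of $\phi\in\mathcal R_d$ with $$\dim\mathrm{Im}\,\phi_{a_i}=r_i\ (1\le i\le 2m),\quad \dim(\mathrm{Im}\,\phi_{a_{2i-1}}+\mathrm{Im}\,\phi_{a_{2i}})=p_i\ (1\le i\le m),$$ $$\dim(\ker\phi_{a_{2i+1}}\cap\ker\phi_{a_{2i}})=q_i\ (1\le i\le m-1).$$ Assume $p_i\neq r_{2i-1},r_{2i}$ and $q_j\neq d_{2j+1}-r_{2j+1},\,d_{2j+1}-r_{2j}$ for $1\le i\le m$ and $1\le j\le m-1$. Then the resolution of singularities of $\overline{\mathcal O}_{r,p,q}$ defined by $W,F$ (see the context) is crepant if and only if $$d_1=d_{2m+1}=p_i\ (1\le i\le m),\qquad q_i=d_{2i+1}-d_1\ (1\le i\le m-1),\qquad r_i=d_{i+1}-r_{i+1}\ (1\le i\le 2m-1).$$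
   Context: $\mathrm{Gr}(\alpha,V_i)$ is the Grassmannian of $\alpha$-dimensional subspaces of $V_i$, and $F(\alpha_1,\alpha_2,V_i)$ is the flag variety in $V_i$ with tautological bundles $\mathcal U_{i,1}\subset\mathcal U_{i,2}$ of ranks $\alpha_1,\alpha_2$. On $\mathrm{Gr}(d_1-r_1,V_1)$ the tautological bundle is denoted $\mathcal U_{1,2}$. Bundles are pulled back to products. $\mathcal R_d=\bigoplus_a\mathrm{Hom}(V_{a(0)},V_{a(1)})$, the sum being over the arrows $a$, with $a(0)$ the source and $a(1)$ the target of $a$. The resolution of $\overline{\mathcal O}_{r,p,q}$ is the total space of $$W=\bigoplus_{i=1}^{m-1}\Big(((V_{2i-1}/\mathcal U_{2i-1,2})^*\otimes\mathcal U_{2i,2})\oplus((V_{2i+1}/\mathcal U_{2i+1,1})^*\otimes\mathcal U_{2i,1})\Big)\oplus((V_{2m-1}/\mathcal U_{2m-1,2})^*\otimes\mathcal U_{2m,2})\oplus(V_{2m+1}^*\otimes\mathcal U_{2m,1})$$ over $$F=\mathrm{Gr}(d_1-r_1,V_1)\times F(r_{2m},p_m,V_{2m})\times\prod_{i=1}^{m-1}\big(F(r_{2i},p_i,V_{2i})\times F(q_i,d_{2i+1}-r_{2i+1},V_{2i+1})\big),$$ viewed as a subbundle of the trivial bundle $\mathcal R_d\times F$ and mapped to $\mathcal R_d$ by projection. The set $\mathcal O_{r,p,q}$ is assumed nonempty, and the subspaces parametrized by the Grassmannian and flag factors of $F$ are assumed nonzero and proper, with strict inclusions in the flags. The resolution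 is crepant if $\det(W)\cong K_F$ as line bundles on $F$ (equivalently, the total space of $W$ has trivial canonical bundle). *)

(* Defs.v *)
From HB Require Import structures.
From mathcomp Require Import all_boot all_order all_algebra.
From mathcomp Require Import boolp classical_sets reals topology normedtype derive.
From mathcomp Require Import complex zify ring.
From mathcomp Require Import -(notations) mpoly.
Set Implicit Arguments.
Unset Strict Implicit.
Unset Printing Implicit Defensive.
Import Order.TTheory GRing.Theory Num.Theory numFieldNormedType.Exports.
Local Open Scope classical_set_scope.
Local Open Scope ring_scope.

Section PolynomialFunctions.
Variables (K : numFieldType) (n : nat).

Definition polyfun (f : 'rV[K]_n -> K) : Prop :=
  exists P : mpoly n K, forall x, f x = meval (fun k => x 0 k) P.

Lemma polyfun_cst c : polyfun (fun=> c).
Proof. by exists (mpolyC n c) => x; rewrite mevalC. Qed.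

Lemma polyfun_coord k : polyfun (fun x => x 0 k).
Proof. by exists (mpolyX K (mnm1 k)) => x; rewrite mevalXU. Qed.

Lemma polyfunD f g : polyfun f -> polyfun g -> polyfun (fun x => f x + g x).
Proof. by move=> [P hP] [Q hQ]; exists (P + Q) => x; rewrite mevalD hP hQ. Qed.

Lemma polyfunM f g : polyfun f -> polyfun g -> polyfun (fun x => f x * g x).
Proof. by move=> [P hP] [Q hQ]; exists (P * Q) => x; rewrite mevalM hP hQ. Qed.

Lemma eq_polyfun f g : f =1 g -> polyfun f -> polyfun g.
Proof. by move=> fg [P hP]; exists P => x; rewrite -fg. Qed.

Lemma polyfun_sum (T : Type) (s : seq T) (A : pred T) (F : T -> 'rV[K]_n -> K) :
  (forall t, A t -> polyfun (F t)) -> polyfun (fun x => \sum_(t <- s | A t) F t x).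
Proof.
move=> hF; elim: s => [|t s IH].
  by apply: eq_polyfun (polyfun_cst 0) => x; rewrite big_nil.
have [At|At] := boolP (A t).
  by apply: eq_polyfun (polyfunD (hF t At) IH) => x; rewrite big_cons At.
by apply: eq_polyfun IH => x; rewrite big_cons (negbTE At).
Qed.

Lemma polyfun_prod (T : Type) (s : seq T) (A : pred T) (F : T -> 'rV[K]_n -> K) :
  (forall t, A t -> polyfun (F t)) -> polyfun (fun x => \prod_(t <- s | A t) F t x).
Proof.
move=> hF; elim: s => [|t s IH].
  by apply: eq_polyfun (polyfun_cst 1) => x; rewrite big_nil.
have [At|At] := boolP (A t).
  by apply: eq_polyfun (polyfunM (hF t At) IH) => x; rewrite big_cons At.
by apply: eq_polyfun IH => x; rewrite big_cons (negbTE At).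
Qed.

Definition polyfun_mx k l (M : 'rV[K]_n -> 'M[K]_(k, l)) : Prop :=
  forall i j, polyfun (fun x => M x i j).

Lemma polyfun_mx_cst k l (A : 'M[K]_(k, l)) : polyfun_mx (fun=> A).
Proof. by move=> i j; apply: polyfun_cst. Qed.

Lemma polyfun_mulmx k l h (M : 'rV[K]_n -> 'M[K]_(k, l)) (N : 'rV[K]_n -> 'M[K]_(l, h)) :
  polyfun_mx M -> polyfun_mx N -> polyfun_mx (fun x => M x *m N x).
Proof.
move=> hM hN i j.
have : polyfun (fun x => \sum_t M x i t * N x t j).
  by apply: polyfun_sum => t _; apply: polyfunM.
by apply: eq_polyfun => x; rewrite mxE.
Qed.

Lemma polyfun_det k (M : 'rV[K]_n -> 'M[K]_k) :
  polyfun_mx M -> polyfun (fun x => \det (M x)).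
Proof.
move=> hM; rewrite /determinant; apply: polyfun_sum => s _.
by apply: polyfunM; [apply: polyfun_cst | apply: polyfun_prod].
Qed.

Lemma polyfun_adj k (M : 'rV[K]_n -> 'M[K]_k) :
  polyfun_mx M -> polyfun_mx (fun x => \adj (M x)).
Proof.
move=> hM i j.
have : polyfun (fun x => cofactor (M x) j i).
  apply: polyfunM; first exact: polyfun_cst.
  apply: polyfun_det => i' j'.
  by apply: eq_polyfun (hM (lift j i') (lift i j')) => x; rewrite !mxE.
by apply: eq_polyfun => x; rewrite mxE.
Qed.

End PolynomialFunctions.

(* A smooth algebraic variety presented by an open cover by affine spaces:
   [chart_glue] says that the charts overlap in open sets and that the change
   of coordinates is a regular map there. *)
Record atlas (K : numFieldType) := Atlas {
  pt : Type;
  adim : nat;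
  aidx : Type;
  chart : aidx -> 'rV[K]_adim -> pt;
  chart_inj : forall i, injective (chart i);
  chart_cover : forall u, exists i x, chart i x = u;
  chart_glue : forall i j x y, chart i x = chart j y ->
    exists (P : 'I_adim -> 'rV[K]_adim -> K) (Q : 'rV[K]_adim -> K),
      [/\ forall k, polyfun (P k), polyfun Q, Q x != 0 &
          forall z, Q z != 0 -> chart j (\row_k (P k z / Q z)) = chart i z]
}.

Section Bundles.
Variables (K : numFieldType) (X : atlas K).
Local Notation n := (adim X).

(* Change of coordinates; meaningful on the points of chart i that lie in chart j. *)
Definition coord_change (i j : aidx X) (x : 'rV[K]_n) : 'rV[K]_n :=
  xget 0 [set y | chart j y = chart i x].

(* A line bundle trivialized over the charts, given by its transition functions:
   with s_i the local generator over chart i, s_i = L i j x * s_j at the point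
   chart i x, whenever that point lies in chart j. *)
Definition line_bundle := aidx X -> aidx X -> 'rV[K]_n -> K.

(* An isomorphism maps the generator s_i of L to f_i s'_i, where f_i is a nowhere
   vanishing regular function on chart i; the equation is agreement on overlaps. *)
Definition lb_iso (L L' : line_bundle) : Prop :=
  exists f : aidx X -> 'rV[K]_n -> K,
    [/\ forall i, polyfun (f i),
        forall i x, f i x != 0 &
        forall i j x y, chart i x = chart j y ->
          f i x * L' i j x = L i j x * f j y].

(* Local generator dx_1 /\ ... /\ dx_n.  In the row convention of 'J, d/dx_k is
   the combination of the d/dy_l given by row k of the Jacobian of the change of
   coordinates y(x), so that dx_1 /\ ... /\ dx_n = (det 'J)^-1 dy_1 /\ ... /\ dy_n. *)
Definition canonical_bundle : line_bundle :=
  fun i j x => (\det ('J (coord_change i j) x))^-1.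

(* A vector subbundle of the trivial bundle with fibre K^N. *)
Record subbundle (N : nat) := Subbundle {
  fibre : pt X -> set 'rV[K]_N;
  sb_rank : nat;
  frame : aidx X -> 'rV[K]_n -> 'M[K]_(sb_rank, N);
  frame_regular : forall i, polyfun_mx (frame i);
  frame_free : forall i x, row_free (frame i x);
  frame_span : forall i x v, (v <= frame i x)%MS <-> fibre (chart i x) v
}.

(* The local generator is the wedge product of the rows of the frame. *)
Definition det_bundle N (E : subbundle N) : line_bundle :=
  fun i j x => \det (frame E i x *m pinvmx (frame E j (coord_change i j x))).

End Bundles.

Arguments canonical_bundle {K} X _ _ _.

Section RowSpan.
Variables (K : numFieldType) (n : nat).
Implicit Types (A B : 'M[K]_n) (s : nat).

(* Span of the first s rows. *)
Definition rowspan B s : {vspace 'rV[K]_n} :=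
  <<[seq row k B | k <- take s (enum 'I_n)]>>%VS.

Lemma mem_take_enum s (k : 'I_n) : (k \in take s (enum 'I_n)) = (k < s)%N.
Proof. by rewrite in_take ?mem_enum // index_enum_ord. Qed.

Lemma rowspanP B s (u : 'rV[K]_n) : B \in unitmx ->
  reflect (forall k : 'I_n, (s <= k)%N -> (u *m invmx B) 0 k = 0) (u \in rowspan B s).
Proof.
move=> Bu; apply: (iffP idP) => [|h].
  rewrite /rowspan -[X in <<X>>%VS]in_tupleE => /coord_span -> k sk.
  rewrite mulmx_suml summxE big1 // => i _; rewrite -scalemxAl mxE.
  have : (in_tuple [seq row k B | k <- take s (enum 'I_n)])`_i
      \in [seq row k B | k <- take s (enum 'I_n)] by apply: mem_nth.
  case/mapP => k'; rewrite mem_take_enum => k's ->.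
  rewrite -row_mul mulmxV // !mxE.
  case: eqP => [kk|]; last by rewrite mulr0.
  by move: k's; rewrite kk ltnNge sk.
rewrite -(mulmxKV Bu u) mulmx_sum_row; apply: memv_suml => k _.
have [sk|ks] := leqP s k; first by rewrite h // scale0r mem0v.
by apply/memvZ/memv_span/map_f; rewrite mem_take_enum.
Qed.

Lemma rowspan_coef B s (u : 'rV[K]_n) : B \in unitmx -> u \in rowspan B s ->
  exists2 w : 'rV[K]_n, (forall k : 'I_n, (s <= k)%N -> w 0 k = 0) & u = w *m B.
Proof. by move=> Bu /(rowspanP _ _ Bu) h; exists (u *m invmx B) => //; rewrite mulmxKV. Qed.

Lemma mulmx_rowspan B s (w : 'rV[K]_n) : B \in unitmx ->
  (forall k : 'I_n, (s <= k)%N -> w 0 k = 0) -> w *m B \in rowspan B s.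
Proof. by move=> Bu h; apply/rowspanP => // k sk; rewrite mulmxK // h. Qed.

Lemma rowspan_basis B : B \in unitmx -> basis_of fullv [seq row k B | k <- enum 'I_n].
Proof.
move=> Bu; rewrite basisEdim size_map size_enum_ord dimvf /dim /= mul1n leqnn andbT.
apply/subvP => u _; have := rowspanP n u Bu; rewrite /rowspan take_oversize ?size_enum_ord //.
by move=> h; apply/h => k; rewrite leqNgt ltn_ord.
Qed.

Lemma dim_rowspan B s : B \in unitmx -> (s <= n)%N -> \dim (rowspan B s) = s.
Proof.
move=> Bu sn; rewrite /rowspan map_take.
have := basis_free (rowspan_basis Bu); rewrite -[X in free X](cat_take_drop s).
move=> /catl_free/eqP ->; rewrite size_take size_map size_enum_ord.
by move: sn; rewrite leq_eqVlt => /orP[/eqP ->|->]; rewrite ?ltnn.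
Qed.

Lemma rowspan_le B s t : (s <= t)%N -> (rowspan B s <= rowspan B t)%VS.
Proof.
move=> st; apply: sub_span => u /mapP[k]; rewrite mem_take_enum => ks ->.
by apply: map_f; rewrite mem_take_enum (leq_trans ks).
Qed.

Lemma row_rowspan B s (k : 'I_n) : (k < s)%N -> row k B \in rowspan B s.
Proof. by move=> ks; apply/memv_span/map_f; rewrite mem_take_enum. Qed.

Lemma rowspan_sub A B s :
  (forall k : 'I_n, (k < s)%N -> row k A \in rowspan B s) ->
  (rowspan A s <= rowspan B s)%VS.
Proof.
by move=> h; apply/span_subvP => u /mapP[k]; rewrite mem_take_enum => /h ? ->.
Qed.

Lemma basis_size (U : {vspace 'rV[K]_n}) X : basis_of U X -> size X = \dim U.
Proof. by move=> bX; move/eqP: (basis_free bX) => <-; rewrite (span_basis bX). Qed.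

Lemma adapted_basis (U1 U2 : {vspace 'rV[K]_n}) : (U1 <= U2)%VS ->
  exists2 B, B \in unitmx & rowspan B (\dim U1) = U1 /\ rowspan B (\dim U2) = U2.
Proof.
move=> U12.
have e : (U2 :&: U1)%VS = U1 by apply/capv_idPr.
pose X12 := vbasis U1 ++ vbasis (U2 :\: U1)%VS.
have b12 : basis_of U2 X12.
  have dU : (U1 + (U2 :\: U1))%VS = U2.
    by rewrite -{1}e addvC addv_diff_cap.
  rewrite -{1}dU; apply: cat_basis; rewrite ?vbasisP //.
  by apply/directv_addP; rewrite capvC capv_diff.
pose X := X12 ++ vbasis (U2^C)%VS.
have bX : basis_of fullv X.
  rewrite -(addv_complf U2); apply: cat_basis; rewrite ?vbasisP //.
  by apply/directv_addP; rewrite capv_compl.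
have sX : size X = n by rewrite (basis_size bX) dimvf /dim /= mul1n.
pose B : 'M[K]_n := \matrix_(k < n) X`_k.
have rX : [seq row k B | k <- enum 'I_n] = X.
  apply: (@eq_from_nth _ 0) => [|k]; first by rewrite size_map size_enum_ord sX.
  rewrite size_map size_enum_ord => kn.
  have k0 : 'I_n := Ordinal kn.
  by rewrite (nth_map k0) ?size_enum_ord // rowK nth_enum_ord.
exists B; last first.
  rewrite /rowspan !map_take rX; split.
    by rewrite /X /X12 -catA take_size_cat ?size_tuple // (span_basis (vbasisP _)).
  by rewrite take_size_cat ?(basis_size b12) // (span_basis b12).
rewrite -row_free_unit -kermx_eq0; apply/eqP/row_matrixP => i; rewrite row0.
set c := row i _.
have cB : c *m B = 0 by apply/sub_kermxP; rewrite row_sub.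
have fX : free X := basis_free bX.
have Xt : size X == n by rewrite sX.
have := (@freeP _ _ n (Tuple Xt) fX (fun k => c 0 k)).
move=> h; apply/rowP => k; rewrite [RHS]mxE; apply: h.
rewrite -[RHS]cB mulmx_sum_row; apply: eq_bigr => j _; by rewrite rowK.
Qed.

End RowSpan.

(* The product over v : I of the flag varieties of pairs of subspaces U1 <= U2 of
   K^(n v) of dimensions a v <= b v. *)
Section FlagProduct.
Variables (K : numFieldType) (I : finType) (n a b : I -> nat).
Hypothesis hab : forall v, (a v <= b v <= n v)%N.

Definition flag_pt := {U : forall v, {vspace 'rV[K]_(n v)} * {vspace 'rV[K]_(n v)} |
  forall v, [/\ ((U v).1 <= (U v).2)%VS, \dim (U v).1 = a v & \dim (U v).2 = b v]}.

Definition blk v (k : nat) : nat := (a v <= k) + (b v <= k).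

(* Coordinates of a chart: the entries strictly above the block diagonal, for
   blocks of sizes a v, b v - a v and n v - b v. *)
Definition fcoord := {c : {v : I & ('I_(n v) * 'I_(n v))%type} |
  (blk (tag c) (tagged c).1 < blk (tag c) (tagged c).2)%N}.

Definition fdim := #|{: fcoord}|.

Definition fentry v (k l : 'I_(n v)) : option fcoord :=
  insub (Tagged (fun v => ('I_(n v) * 'I_(n v))%type) (k, l)).

Definition unip (x : 'rV[K]_fdim) v : 'M[K]_(n v) :=
  \matrix_(k, l) if fentry k l is Some c then x 0 (enum_rank c) else (k == l)%:R.

Definition bases := {g : forall v, 'M[K]_(n v) | forall v, g v \in unitmx}.

(* The adapted basis of the flag with coordinates x in the chart given by the
   bases g: its first a v (resp. b v) rows span U1 (resp. U2). *)
Definition adapted (g : bases) x v : 'M[K]_(n v) := unip x v *m sval g v.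

Lemma fentryP v (k l : 'I_(n v)) :
  if fentry k l is Some c then
    val c = Tagged (fun v => ('I_(n v) * 'I_(n v))%type) (k, l)
  else (blk v l <= blk v k)%N.
Proof.
rewrite /fentry; case: insubP => [c _ -> //|/=].
by rewrite -leqNgt.
Qed.

Lemma unip_lower x v (k l : 'I_(n v)) : (blk v l <= blk v k)%N ->
  unip x v k l = (k == l)%:R.
Proof.
move=> h; rewrite mxE; have := fentryP k l; case: (fentry k l) => // c hc.
by have := valP c; rewrite hc /= ltnNge h.
Qed.

Lemma blk_mono v (k l : nat) : (k <= l)%N -> (blk v k <= blk v l)%N.
Proof.
by move=> kl; rewrite /blk; lia.
Qed.

Lemma unip_trig x v : is_trig_mx (unip x v)^T.
Proof.
apply/is_trig_mxP => i j ij; rewrite mxE unip_lower; last by apply: blk_mono; apply: ltnW.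
by case: eqP => // e; move: ij; rewrite e ltnn.
Qed.

Lemma det_unip x v : \det (unip x v) = 1.
Proof.
rewrite -det_tr (det_trig (unip_trig x v)) big1 // => i _.
by rewrite mxE unip_lower // eqxx.
Qed.

Lemma unip_unit x v : unip x v \in unitmx.
Proof. by rewrite unitmxE det_unip unitr1. Qed.

Lemma adapted_unit g x v : adapted g x v \in unitmx.
Proof. by rewrite unitmx_mul unip_unit (svalP g v). Qed.

Definition flag_chart_fun (g : bases) x v :=
  (rowspan (adapted g x v) (a v), rowspan (adapted g x v) (b v)).

Lemma flag_chartP g x v : let U := flag_chart_fun g x v in
  [/\ (U.1 <= U.2)%VS, \dim U.1 = a v & \dim U.2 = b v].
Proof.
case/andP: (hab v) => ab bn /=; rewrite rowspan_le // !dim_rowspan ?adapted_unit //.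
exact: leq_trans bn.
Qed.

Definition flag_chart g x : flag_pt := exist _ (flag_chart_fun g x) (flag_chartP g x).

Lemma flag_chart_eq g h x y : flag_chart g x = flag_chart h y <->
  forall v s, s = a v \/ s = b v ->
    rowspan (adapted g x v) s = rowspan (adapted h y v) s.
Proof.
split=> [/(congr1 sval)/= e v s|e].
  have := congr1 (fun U => U v) e; rewrite /flag_chart_fun => -[e1 e2].
  by case=> ->.
apply/eq_exist/functional_extensionality_dep => v.
by rewrite /flag_chart_fun !e //; [right|left].
Qed.

(* A combination of the first s rows of a unipotent matrix is determined by its
   first s entries. *)
Lemma unip_inj x v s (w : 'rV[K]_(n v)) :
  (forall k : 'I_(n v), (s <= k)%N -> w 0 k = 0) ->
  (forall l : 'I_(n v), (l < s)%N -> (w *m unip x v) 0 l = 0) -> w = 0.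
Proof.
move=> w0 wu0; apply/rowP => l; rewrite [RHS]mxE.
have [m] := ubnP (val l); elim: m l => // m IH l lm.
have [sl|ls] := leqP s l; first exact: w0.
have := wu0 l ls; rewrite mxE (bigD1 l) //= unip_lower // eqxx mulr1.
rewrite big1 ?addr0 // => k kl; have [klt|lk] := ltnP k l.
  by rewrite IH ?mul0r // (leq_trans klt).
by rewrite unip_lower ?(negbTE kl) ?mulr0 //; apply: blk_mono.
Qed.

Definition cut v (k : 'I_(n v)) : nat := if (k < a v)%N then a v else b v.

Lemma cut_or v (k : 'I_(n v)) : cut k = a v \/ cut k = b v.
Proof. by rewrite /cut; case: ifP; [left|right]. Qed.

Lemma lt_cut v (k l : 'I_(n v)) : (k < b v)%N ->
  (blk v k < blk v l)%N = (cut k <= l)%N.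
Proof.
by move=> kb; have := hab v; rewrite /cut /blk; case: (ltnP k (a v)); lia.
Qed.

Lemma blk_top v (k l : 'I_(n v)) : (b v <= k)%N -> (blk v l <= blk v k)%N.
Proof.
by move=> bk; have := hab v; rewrite /blk; lia.
Qed.

Lemma flag_chart_inj g : injective (flag_chart g).
Proof.
move=> x y /flag_chart_eq e; apply/rowP => i.
rewrite -(enum_valK i); move: (enum_val i) => {i} -[[v [k l]] hc].
pose c : fcoord := exist _ (Tagged (fun v => ('I_(n v) * 'I_(n v))%type) (k, l)) hc.
have un z : unip z v k l = z 0 (enum_rank c).
  rewrite mxE; have := fentryP k l; case: (fentry k l) => [c' e'|].
    by congr (z 0 (enum_rank _)); apply: val_inj.
  by rewrite leqNgt hc.
rewrite -/c -!un.
have kb : (k < b v)%N.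
  by rewrite ltnNge; apply/negP => /blk_top bk; have := hc; rewrite /= ltnNge bk.
have kc : (k < cut k)%N by rewrite /cut; case: ifP.
suff : row k (unip x v) = row k (unip y v) by move/rowP/(_ l); rewrite !mxE.
have := row_rowspan (adapted g y v) kc.
rewrite -(e v _ (cut_or k)) => /(rowspan_coef (adapted_unit g x v))[w w0].
rewrite row_mul mulmxA => /(can_inj (mulmxK (svalP g v))) Ew.
have : w - delta_mx 0 k = 0.
  apply: (@unip_inj x v (cut k)) => [k' ck|l' lc].
    rewrite !mxE w0 // eqxx /=; case: eqP => [e'|]; last by rewrite subr0.
    by move: ck; rewrite e' leqNgt kc.
  have bl : (blk v l' <= blk v k)%N by rewrite leqNgt lt_cut // -ltnNge.
  rewrite mulmxBl -Ew -rowE mxE [X in X + _]mxE [X in _ + X]mxE [row k _ _ _]mxE.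
  by rewrite !unip_lower // subrr.
by move/eqP; rewrite subr_eq0 => /eqP Ed; rewrite Ew Ed -rowE.
Qed.

Lemma unip0 v : unip 0 v = 1%:M.
Proof.
apply/matrixP => k l; rewrite !mxE; have := fentryP k l.
case: (fentry k l) => // c hc; rewrite mxE; have := valP c; rewrite hc /=.
by case: eqP => // ->; rewrite ltnn.
Qed.

Lemma flag_chart_cover (U : flag_pt) : exists g x, flag_chart g x = U.
Proof.
case: U => U hU.
pose B v := cid2 (adapted_basis (let: And3 h _ _ := hU v in h)).
pose g : bases := exist (fun g : forall v, 'M[K]_(n v) => forall v, g v \in unitmx)
  (fun v => s2val (B v)) (fun v => s2valP (B v)).
exists g, 0; apply/eq_exist/functional_extensionality_dep => v.
rewrite /flag_chart_fun /adapted unip0 mul1mx /=.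
have [e1 e2] := s2valP' (B v); have [_ d1 d2] := hU v.
by rewrite -[in X in (X, _)]d1 -[in X in (_, X)]d2 e1 e2 -surjective_pairing.
Qed.

Lemma polyfun_unip v : polyfun_mx (fun x => unip x v).
Proof.
move=> k l; case E: (fentry k l) => [c|].
  by apply: eq_polyfun (polyfun_coord _ (enum_rank c)) => x; rewrite mxE E.
by apply: eq_polyfun (polyfun_cst _ (k == l)%:R) => x; rewrite mxE E.
Qed.

Lemma polyfun_adapted g v : polyfun_mx (fun x => adapted g x v).
Proof. exact: (polyfun_mulmx (@polyfun_unip v) (polyfun_mx_cst _ (sval _ v))). Qed.

Lemma polyfun_invmx_adapted g v : polyfun_mx (fun x => invmx (adapted g x v)).
Proof.
move=> k l.
have : polyfun (fun x => (\det (sval g v))^-1 * (\adj (adapted g x v)) k l).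
  apply: polyfunM; first exact: polyfun_cst.
  by apply: polyfun_adj => i j; apply: polyfun_adapted.
apply: eq_polyfun => x.
by rewrite /invmx adapted_unit [RHS]mxE {2}/adapted det_mulmx det_unip mul1r.
Qed.

(* The leading s x s submatrix, completed by the identity. *)
Definition cutmx v s (M : 'M[K]_(n v)) : 'M[K]_(n v) :=
  \matrix_(k, l) if (k < s)%N && (l < s)%N then M k l else (k == l)%:R.

Lemma polyfun_cutmx v s (M : 'rV[K]_fdim -> 'M[K]_(n v)) :
  polyfun_mx M -> polyfun_mx (fun x => cutmx s (M x)).
Proof.
move=> hM k l; case E : ((k < s)%N && (l < s)%N).
  by apply: eq_polyfun (hM k l) => x; rewrite mxE E.
by apply: eq_polyfun (polyfun_cst _ (k == l)%:R) => x; rewrite mxE E.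
Qed.

Lemma mul_cutmx v s (M : 'M[K]_(n v)) (w : 'rV[K]_(n v)) (l : 'I_(n v)) : (l < s)%N ->
  (w *m cutmx s M) 0 l = \sum_(k < n v | (k < s)%N) w 0 k * M k l.
Proof.
move=> ls; rewrite mxE [RHS]big_mkcond; apply: eq_bigr => k _; rewrite mxE ls andbT.
case: ltnP => // sk; case: eqP => [e|]; last by rewrite mulr0.
by move: sk; rewrite e leqNgt ls.
Qed.

Lemma cutmx_unit g h x y v s : s = a v \/ s = b v ->
  rowspan (adapted g x v) s = rowspan (adapted h y v) s ->
  cutmx s (adapted g x v *m invmx (sval h v)) \in unitmx.
Proof.
move=> hs e; set M := _ *m _; have hu := svalP h v; rewrite -/(sval h) in hu.
rewrite -row_free_unit -kermx_eq0; apply/eqP/row_matrixP => i; rewrite row0.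
set c := row i _; have cM : c *m cutmx s M = 0 by apply/sub_kermxP; rewrite row_sub.
have c0 (k : 'I_(n v)) : (s <= k)%N -> c 0 k = 0.
  move=> sk; have := congr1 (fun w : 'rV_(n v) => w 0 k) cM.
  rewrite mxE (bigD1 k) //= big1 => [|j jk]; last first.
    rewrite [cutmx _ _ _ _]mxE. move: (ltnNge k s). rewrite sk /= => ->. by rewrite andbF (negbTE jk) mulr0.
  by rewrite [cutmx _ _ _ _]mxE ltnNge sk /= eqxx mulr1 addr0 => ->; rewrite mxE.
have : c *m adapted g x v \in rowspan (adapted h y v) s.
  by rewrite -e mulmx_rowspan ?adapted_unit.
move=> /(rowspan_coef (adapted_unit h y v))[w w0 ew].
have eM : c *m M = w *m unip y v by rewrite mulmxA ew mulmxA mulmxK.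
have w_0 : w = 0.
  apply: (@unip_inj y v s) => // l ls; rewrite -eM.
  have := congr1 (fun w : 'rV_(n v) => w 0 l) cM; rewrite mul_cutmx // => e0.
  rewrite mxE; transitivity ((0 : 'rV[K]_(n v)) 0 l); last by rewrite mxE.
  rewrite -e0 [RHS]big_mkcond; apply: eq_bigr => k _.
  by case: ltnP => // sk; rewrite c0 // mul0r.
by apply: (can_inj (mulmxK (adapted_unit g x v))); rewrite ew w_0 !mul0mx.
Qed.

Lemma flag_chart_glue g h x y : flag_chart g x = flag_chart h y ->
  exists (P : 'I_fdim -> 'rV[K]_fdim -> K) (Q : 'rV[K]_fdim -> K),
    [/\ forall k, polyfun (P k), polyfun Q, Q x != 0 &
        forall z, Q z != 0 -> flag_chart h (\row_k (P k z / Q z)) = flag_chart g z].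
Proof.
move=> /flag_chart_eq e.
pose M z v := adapted g z v *m invmx (sval h v).
pose D (t : I -> nat) z v := \det (cutmx (t v) (M z v)).
pose Q z := \prod_v (D a z v * D b z v).
have polyM v : polyfun_mx (M^~ v).
  exact: (polyfun_mulmx (@polyfun_adapted g v) (polyfun_mx_cst _ (invmx (sval h v)))).
have polyD t v : polyfun (fun z => D t z v).
  exact: (polyfun_det (polyfun_cutmx _ (polyM v))).
pose num v (k l : 'I_(n v)) z :=
  \sum_(j < n v | (j < cut k)%N) (\adj (cutmx (cut k) (M z v))) k j * M z v j l.
pose oth v (k : 'I_(n v)) z :=
  (if (k < a v)%N then D b z v else D a z v)
  * \prod_(u | u != v) (D a z u * D b z u).
pose P (i : 'I_fdim) z := let c := val (enum_val i : fcoord) in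
  num (tag c) (tagged c).1 (tagged c).2 z * oth (tag c) (tagged c).1 z.
exists P, Q; split.
- move=> i; set c := val (enum_val i : fcoord).
  apply: (@polyfunM _ _ (num (tag c) (tagged c).1 (tagged c).2) (oth (tag c) (tagged c).1)).
    apply: polyfun_sum => j _; apply: polyfunM; last exact: polyM.
    exact: (polyfun_adj (polyfun_cutmx _ (polyM _))).
  apply: polyfunM; first by case: (_ < _)%N; apply: polyD.
  by apply: polyfun_prod => u _; apply: polyfunM; apply: polyD.
- by apply: polyfun_prod => u _; apply: polyfunM; apply: polyD.
- apply/prodf_neq0 => v _; apply: mulf_neq0; rewrite /D -unitfE -unitmxE.
    by apply: (cutmx_unit (y := y)); [left | apply: e; left].
  by apply: (cutmx_unit (y := y)); [right | apply: e; right].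
move=> z /prodf_neq0 Qz; apply/flag_chart_eq => v s hs.
set y' := \row_k _.
have {}Qz0 v' : D a z v' != 0 /\ D b z v' != 0.
  by apply/andP; rewrite -negb_or -mulf_eq0; apply: Qz.
have sn : (s <= n v)%N by case/andP: (hab v) => ab bn; case: hs => -> //; apply: leq_trans bn.
apply/eqP; rewrite eqEdim !dim_rowspan ?adapted_unit // leqnn andbT.
apply: rowspan_sub => k ks.
have kb : (k < b v)%N.
  by case/andP: (hab v) => ab _; case: hs ks => -> // /leq_trans; apply.
have cs : (cut k <= s)%N by case/andP: (hab v) => ab _; case: hs ks; rewrite /cut => -> ?; case: ifP; lia.
have Dk : \det (cutmx (cut k) (M z v)) != 0.
  by case: (Qz0 v) => qa qb; rewrite /cut; case: ifP.
pose w : 'rV[K]_(n v) := \row_j (if (j < cut k)%N then invmx (cutmx (cut k) (M z v)) k j else 0).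
have rw : row k (unip y' v) = w *m M z v.
  have wM l : (w *m M z v) 0 l = num v k l z / \det (cutmx (cut k) (M z v)).
    rewrite mxE mulr_suml [RHS]big_mkcond; apply: eq_bigr => j _; rewrite mxE.
    case: ifP => _; last by rewrite mul0r.
    by rewrite /invmx unitmxE unitfE Dk mxE -[LHS]mulrA [LHS]mulrC.
  apply/rowP => l; rewrite mxE; have [bl|bl] := leqP (blk v l) (blk v k).
    rewrite unip_lower //.
    have lk : (l < cut k)%N by rewrite ltnNge -lt_cut // -leqNgt.
    have := congr1 (fun A : 'M_(n v) => A k l)
      (mulVmx (_ : cutmx (cut k) (M z v) \in unitmx)).
    rewrite unitmxE unitfE Dk => /(_ isT); rewrite [1%:M k l]mxE => <-.
    have := mul_cutmx (M z v) (row k (invmx (cutmx (cut k) (M z v)))) lk.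
    rewrite -row_mul mxE => ->; rewrite mxE [LHS]big_mkcond; apply: eq_bigr => j _.
    by rewrite !mxE; case: ifP => // _; rewrite mul0r.
  rewrite wM mxE; have := fentryP k l; case: (fentry k l) => [c hc|]; last by rewrite leqNgt bl.
  rewrite mxE /P enum_rankK hc /= /oth.
  set p := \prod_(_ | _) _; have -> : Q z = D a z v * D b z v * p by rewrite /Q (bigD1 v).
  have p0 : p != 0.
    by apply/prodf_neq0 => u _; case: (Qz0 u) => qa qb; rewrite mulf_neq0.
  case: (Qz0 v) => qa qb; rewrite -/(D a z v) -/(D b z v) /cut; case: ifP => _.
    by rewrite -[\det _]/(D a z v); field; rewrite qa qb p0.
  by rewrite -[\det _]/(D b z v); field; rewrite qa qb p0.
rewrite /adapted row_mul rw /M -mulmxA mulmxKV ?(svalP h v) //.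
apply: mulmx_rowspan; first exact: adapted_unit.
by move=> j sj; rewrite mxE ltnNge (leq_trans cs sj).
Qed.

Definition flag_atlas : atlas K :=
  Atlas flag_chart_inj flag_chart_cover flag_chart_glue.

End FlagProduct.

(* The source-sink quiver of type A_(2m+1) with vertices s_1, ..., s_(2m+1).  The
   dimension vector d and the vectors r, p, q are functions on nat, read only at
   their usual 1-based indices; the ordinal v : 'I_(2m+1) stands for s_(v+1), with
   V_(v+1) = K^(d (v+1)).  Vectors are rows and maps act on the right. *)

(* With k : 'I_m, (k, true) is a_(2k+1) : s_(2k+1) -> s_(2k+2) and (k, false) is
   a_(2k+2) : s_(2k+3) -> s_(2k+2). *)
Definition arrow m := ('I_m * bool)%type.

Lemma source_subproof m (e : arrow m) :
  ((if e.2 then e.1.*2 else e.1.*2.+2) < m.*2.+1)%N.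
Proof. by have := ltn_ord e.1; case: e.2; lia. Qed.

Lemma target_subproof m (e : arrow m) : (e.1.*2.+1 < m.*2.+1)%N.
Proof. by have := ltn_ord e.1; lia. Qed.

Definition source m (e : arrow m) : 'I_m.*2.+1 := Ordinal (source_subproof e).
Definition target m (e : arrow m) : 'I_m.*2.+1 := Ordinal (target_subproof e).

Lemma cancel_invmx (K : fieldType) h k l t (c : 'M[K]_(h, k)) B (X : 'M_(k, l)) (T : 'M_(l, t)) :
  B \in unitmx -> c *m B *m (invmx B *m X *m T) = c *m X *m T.
Proof. by move=> Bu; rewrite !mulmxA mulmxK. Qed.

Lemma conj_invmx (K : fieldType) k l (B : 'M[K]_k) (X : 'M_(k, l)) (T : 'M_l) :
  B \in unitmx -> T \in unitmx -> invmx B *m (B *m X *m invmx T) *m T = X.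
Proof. by move=> Bu Tu; rewrite !mulmxA mulVmx // mul1mx mulmxKV. Qed.

Section Representations.
Variables (K : numFieldType) (m : nat) (d : nat -> nat).

Definition vdim (v : 'I_m.*2.+1) : nat := d v.+1.

Definition rep_coord :=
  {e : arrow m & ('I_(vdim (source e)) * 'I_(vdim (target e)))%type}.

Definition rep_dim := #|{: rep_coord}|.

(* The representation space, as the space of all entries of the matrices of the
   arrows. *)
Definition rep := 'rV[K]_rep_dim.

Definition rep_map (phi : rep) (e : arrow m) : 'M[K]_(vdim (source e), vdim (target e)) :=
  \matrix_(k, l) phi 0 (enum_rank (existT _ e (k, l) : rep_coord)).

Definition orbit_set (r p q : nat -> nat) : set rep := [set phi |
  [/\ forall k : 'I_m, \rank (rep_map phi (k, true)) = r k.*2.+1 /\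
                       \rank (rep_map phi (k, false)) = r k.*2.+2,
      forall k : 'I_m,
        \rank (rep_map phi (k, true) + rep_map phi (k, false))%MS = p k.+1 &
      forall (k : nat) (km : (k < m)%N) (k1m : (k.+1 < m)%N),
        \rank (kermx (rep_map phi (Ordinal k1m, true))
               :&: kermx (rep_map phi (Ordinal km, false)))%MS = q k.+1]].

Variables a b : 'I_m.*2.+1 -> nat.
Hypothesis hab : forall v, (a v <= b v <= vdim v)%N.
Local Notation F := (flag_atlas K hab).

(* The subspaces attached to a_(2k+1) are U_2 at both ends, those attached to
   a_(2k+2) are U_1 at both ends. *)
Definition flag_part (e : arrow m) (U : pt F) v : {vspace 'rV[K]_(vdim v)} :=
  if e.2 then (sval U v).2 else (sval U v).1.

Definition part_dim (e : arrow m) v : nat := if e.2 then b v else a v.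

(* The direct sum over the arrows e of (V_s / U_s)^* (x) U_t, where s and t are the
   source and the target of e: the maps that kill U_s and take values in U_t. *)
Definition W_fibre (U : pt F) : set rep := [set phi | forall e : arrow m,
  (forall u, u \in flag_part e U (source e) -> u *m rep_map phi e = 0) /\
  (forall u, u *m rep_map phi e \in flag_part e U (target e))].

Definition W_coord := {c : rep_coord |
  (part_dim (tag c) (source (tag c)) <= (tagged c).1)%N &&
  ((tagged c).2 < part_dim (tag c) (target (tag c)))%N}.

Definition W_rank := #|{: W_coord}|.

Definition elem_map (c : W_coord) (e : arrow m) :
    'M[K]_(vdim (source e), vdim (target e)) :=
  \matrix_(k, l) ((existT _ e (k, l) : rep_coord) == val c)%:R.

(* The frame of the tensors of a dual basis vector of V_s / U_s with a basis vector
   of U_t, in the adapted bases of V_s and V_t. *)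
Definition W_frame (g : aidx F) (x : 'rV[K]_(adim F)) : 'M[K]_(W_rank, rep_dim) :=
  \matrix_(i, j) let e := tag (enum_val j : rep_coord) in
    (invmx (adapted g x (source e)) *m elem_map (enum_val i) e *m adapted g x (target e))
      (tagged (enum_val j : rep_coord)).1 (tagged (enum_val j : rep_coord)).2.

Lemma W_frame_regular g : polyfun_mx (W_frame g).
Proof.
move=> i j; set c : rep_coord := enum_val j.
have := @polyfun_mulmx _ _ _ _ _ _ _
  (polyfun_mulmx (@polyfun_invmx_adapted _ _ _ _ _ g (source (tag c)))
     (polyfun_mx_cst _ (elem_map (enum_val i) (tag c))))
  (@polyfun_adapted _ _ _ _ _ g (target (tag c))).
by move=> /(_ a b (tagged c).1 (tagged c).2); apply: eq_polyfun => x; rewrite [RHS]mxE.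
Qed.

Definition W_coef (w : 'rV[K]_W_rank) (e : arrow m) :
    'M[K]_(vdim (source e), vdim (target e)) :=
  \sum_i w 0 i *: elem_map (enum_val i) e.

Lemma W_coefE w e k l : W_coef w e k l =
  if (insub (existT _ e (k, l) : rep_coord) : option W_coord) is Some c
  then w 0 (enum_rank c) else 0.
Proof.
rewrite /W_coef summxE; case: insubP => [c _ hc|hN].
  rewrite (bigD1 (enum_rank c)) //= big1 => [|i ic].
    by rewrite !mxE enum_rankK hc eqxx mulr1 addr0.
  rewrite !mxE -hc; case: eqP => [/val_inj e'|]; last by rewrite mulr0.
  by move: ic; rewrite e' enum_valK eqxx.
rewrite big1 // => i _; rewrite !mxE; case: eqP => [e'|]; last by rewrite mulr0.
by move: hN; rewrite e' (valP (enum_val i)).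
Qed.

Lemma rep_map_frame g x w e : rep_map (w *m W_frame g x) e =
  invmx (adapted g x (source e)) *m W_coef w e *m adapted g x (target e).
Proof.
apply/matrixP => k l; rewrite [LHS]mxE [LHS]mxE /W_coef mulmx_sumr mulmx_suml summxE.
by apply: eq_bigr => i _; rewrite mxE enum_rankK -scalemxAr -scalemxAl [RHS]mxE.
Qed.

Lemma rep_mapI (phi psi : rep) : (forall e, rep_map phi e = rep_map psi e) -> phi = psi.
Proof.
move=> h; apply/rowP => j; rewrite -(enum_valK j); case: (enum_val j) => e [k l].
by have := congr1 (fun A : 'M_(_, _) => A k l) (h e); rewrite !mxE.
Qed.

Lemma rep_map0 e : rep_map 0 e = 0.
Proof. by apply/matrixP => k l; rewrite !mxE. Qed.

Lemma W_frame_free g x : row_free (W_frame g x).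
Proof.
rewrite -kermx_eq0; apply/eqP/row_matrixP => i; rewrite row0.
set w := row i _; have w0 : w *m W_frame g x = 0 by apply/sub_kermxP; rewrite row_sub.
apply/rowP => j; rewrite [RHS]mxE; case E : (val (enum_val j)) => [e [k l]].
have := rep_map_frame g x w e; rewrite w0 rep_map0 => /esym h.
have {}h : W_coef w e = 0.
  rewrite -[W_coef w e](mulKVmx (adapted_unit g x (source e))).
  by rewrite -[_ *m W_coef _ _](mulmxK (adapted_unit g x (target e))) h mul0mx mulmx0.
have := congr1 (fun A : 'M_(_, _) => A k l) h; rewrite W_coefE [RHS]mxE.
by rewrite -E valK enum_valK.
Qed.

Lemma W_frame_span g x (phi : rep) :
  (phi <= W_frame g x)%MS <-> W_fibre (chart g x) phi.
Proof.
have part e v : flag_part e (chart g x) v = rowspan (adapted g x v) (part_dim e v).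
  by rewrite /flag_part /part_dim; case: e.2.
split=> [/submxP[w ->] e|h].
  rewrite !part rep_map_frame; split=> u.
    case/(rowspan_coef (adapted_unit g x (source e))) => c c0 ->.
    rewrite cancel_invmx ?adapted_unit //.
    suff -> : c *m W_coef w e = 0 by rewrite mul0mx.
    apply/rowP => l; rewrite !mxE big1 // => k _; rewrite W_coefE.
    case: insubP => [c' /= /andP[h _] _|]; last by rewrite mulr0.
    by rewrite c0 ?mul0r.
  rewrite mulmxA; apply: mulmx_rowspan => [|l hl]; first exact: adapted_unit.
  rewrite mulmxA mxE big1 // => k _; rewrite W_coefE.
  case: insubP => [c' /= /andP[_ h] _|]; last by rewrite mulr0.
  by move: h; rewrite ltnNge hl.
pose C e := adapted g x (source e) *m rep_map phi e *m invmx (adapted g x (target e)).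
pose w : 'rV[K]_W_rank := \row_i let c := val (enum_val i) in
  C (tag c) (tagged c).1 (tagged c).2.
apply/submxP; exists w; apply: rep_mapI => e; rewrite rep_map_frame.
suff -> : W_coef w e = C e.
  by rewrite /C conj_invmx ?adapted_unit.
apply/matrixP => k l; rewrite W_coefE; case: insubP => [c _ hc|].
  by rewrite mxE enum_rankK hc.
rewrite negb_and -ltnNge -leqNgt /=; have [h1 h2] := h e; case/orP => hkl.
  have := h1 (row k (adapted g x (source e))); rewrite part row_rowspan // => /(_ isT) h0.
  have : row k (C e) = 0 by rewrite /C 2!row_mul h0 mul0mx.
  by move/rowP/(_ l); rewrite mxE [RHS]mxE => ->.
have := h2 (row k (adapted g x (source e))); rewrite part.
move=> /(rowspanP _ _ (adapted_unit g x (target e))) -/(_ l hkl) h0.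
by rewrite -[LHS]h0 -2!row_mul [LHS]mxE.
Qed.

Definition W_bundle : subbundle F rep_dim :=
  Subbundle W_frame_regular W_frame_free W_frame_span.

End Representations.

(* The ranks of the tautological bundles at s_j.  The factor Gr(d_1 - r_1, V_1) is
   taken as the variety of flags with U_1 = 0, and s_(2m+1), which has no factor in
   F, carries the one-point variety of flags with U_1 = U_2 = 0; so the summand
   V_(2m+1)^* (x) U_(2m,1) of W has the general form (V/U_1)^* (x) U_(2m,1). *)
Definition taut1 m (r q : nat -> nat) (j : nat) : nat :=
  if odd j then (if (j == 1%N) || (j == m.*2.+1) then 0%N else q j./2) else r j.

Definition taut2 m (d r p : nat -> nat) (j : nat) : nat :=
  if odd j then (if j == m.*2.+1 then 0%N else (d j - r j)%N) else p j./2.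

(* The subspaces in the factors of F are nonzero and proper, with strict inclusions. *)
Definition strict_flags m (d r p q : nat -> nat) : Prop :=
  [/\ (0 < d 1%N - r 1%N < d 1%N)%N,
      forall i, (1 <= i <= m)%N ->
        [/\ (0 < r i.*2)%N, (r i.*2 < p i)%N & (p i < d i.*2)%N] &
      forall i, (1 <= i < m)%N ->
        [/\ (0 < q i)%N, (q i < d i.*2.+1 - r i.*2.+1)%N &
            (d i.*2.+1 - r i.*2.+1 < d i.*2.+1)%N]].

Section Resolution.
Variables (K : numFieldType) (m : nat) (d r p q : nat -> nat).
Hypothesis hF : strict_flags m d r p q.

Lemma taut_le (v : 'I_m.*2.+1) :
  (taut1 m r q v.+1 <= taut2 m d r p v.+1 <= vdim d v)%N.
Proof.
case: hF => h1 h2 h3; have jm := ltn_ord v; rewrite /vdim /taut1 /taut2.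
have j0 : (0 < v.+1)%N by [].
move: (nat_of_ord v).+1 jm j0 => j jm j0; have ej := odd_double_half j.
case: ifP => oj; rewrite oj ?add1n ?add0n in ej.
  have [_|/negbTE jn] := boolP (j == m.*2.+1); first by rewrite orbT.
  rewrite orbF; have [_|/negbTE j1] := boolP (j == 1%N); first by rewrite leq_subr.
  have /h3 : (1 <= j./2 < m)%N by lia.
  by rewrite ej => -[_ /ltnW -> /ltnW ->].
have /h2 : (1 <= j./2 <= m)%N by lia.
by rewrite ej => -[_ /ltnW -> /ltnW ->].
Qed.

Definition F : atlas K := flag_atlas K taut_le.
Definition W : subbundle F (rep_dim m d) := W_bundle K taut_le.

Definition crepant : Prop := lb_iso (det_bundle W) (canonical_bundle F).

End Resolution.

(* Main.v *)
Require Import Defs.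
From HB Require Import structures.
From mathcomp Require Import all_boot all_order all_algebra.
From mathcomp Require Import boolp classical_sets functions reals topology normedtype landau derive.
From mathcomp Require Import complex zify ring.
From mathcomp Require Import -(notations) mpoly.
Import Order.TTheory GRing.Theory Num.Theory numFieldNormedType.Exports.
Set Implicit Arguments.
Unset Strict Implicit.
Unset Printing Implicit Defensive.
Local Open Scope ring_scope.

(* At a point common to two charts, the adapted bases A and B at a vertex are related
   by A = T B with T block lower triangular, and the leading s x s minor delta_s of T
   is the transition function of det U for the tautological bundle U of rank s.  In adapted coordinates the
   fibre of W transforms by C |-> T_s^-1 C T_t, so det W has as transition function a
   monomial in the delta's.  Differentiating A(z) = T(z) B(y(z)) modulo block lower
   triangular matrices shows that the Jacobian of a change of charts is, up to
   unipotent factors, the inverse of the action Z |-> T Z T^-1 on gl / p; hence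
   K_F has the transition function prod_v delta_a^b delta_b^(n - a), where a <= b <= n
   are the dimensions at v.  Both formulas hold up to powers of det T, which only
   depend on the bases of the charts and form a coboundary, so equal exponents give an
   isomorphism.  Conversely, the local functions of an isomorphism are nowhere
   vanishing polynomials, hence constant, and along a projective line in F that moves
   only one tautological subspace its delta is the coordinate t while all the others
   are constant, so the exponents agree. *)

(** * Determinants of sparse block sums *)

Section Determinants.
Variable K : comNzRingType.

(* Sylvester's identity, from the two block triangularizations of [[1, -A], [B, 1]]. *)
Lemma det_add1_mulmxC n k (A : 'M[K]_(n, k)) (B : 'M_(k, n)) :
  \det (1%:M + A *m B) = \det (1%:M + B *m A).
Proof.
pose C := block_mx 1%:M (- A) B 1%:M.
have e1 : block_mx 1%:M 0 (- B) 1%:M *m C = block_mx 1%:M (- A) 0 (1%:M + B *m A).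
  rewrite mulmx_block !mul1mx !mul0mx !mulmx1 !addr0 mulNmx mulmxN opprK addNr.
  by rewrite addrC.
have e2 : C *m block_mx 1%:M 0 (- B) 1%:M = block_mx (1%:M + A *m B) (- A) 0 1%:M.
  by rewrite mulmx_block !mul1mx !mulmx1 !mulmx0 !add0r mulmxN mulNmx opprK subrr.
have := congr1 determinant e1; have := congr1 determinant e2.
by rewrite !det_mulmx !det_ublock !det_lblock !det1 !mul1r !mulr1 => -> .
Qed.

(** As the terms annihilate each other, all cross terms vanish and [1%:M + \sum_t E t] is the
    product of the factors [1%:M + E t]. *)
Lemma det_add1_sum (T : eqType) n (E : T -> 'M[K]_n) (s : seq T) : uniq s ->
  (forall t u, t != u -> E t *m E u = 0) ->
  \det (1%:M + \sum_(t <- s) E t) = \prod_(t <- s) \det (1%:M + E t).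
Proof.
move=> + E0; elim: s => [|t s IH] /=; first by rewrite !big_nil addr0 det1.
case/andP=> ts us; rewrite !big_cons -IH // -det_mulmx; congr (\det _).
have EE0 : \sum_(u <- s) E t *m E u = 0.
  by rewrite big_seq big1 // => u us'; apply: E0; apply: contraNneq ts => ->.
by rewrite mulmxDl !mulmxDr !mulmx1 mul1mx mulmx_sumr EE0 addr0 addrAC addrA.
Qed.

(** Completing by the identity keeps the size independent of [S]; the determinant is the principal
    minor on [S]. *)
Definition minormx n (S : pred 'I_n) (M : 'M[K]_n) : 'M[K]_n :=
  \matrix_(k, l) if S k && S l then M k l else (k == l)%:R.

Lemma tr_minormx n (S : pred 'I_n) M : (minormx S M)^T = minormx S M^T.
Proof. by apply/matrixP => k l; rewrite !mxE andbC eq_sym. Qed.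

Lemma minormx1 n (S : pred 'I_n) : minormx S 1%:M = 1%:M.
Proof. by apply/matrixP => k l; rewrite !mxE; case: ifP. Qed.

Lemma minormx0 n (S : pred 'I_n) M : S =1 pred0 -> minormx S M = 1%:M.
Proof. by move=> S0; apply/matrixP => k l; rewrite !mxE S0. Qed.

Lemma minormxT n (S : pred 'I_n) M : S =1 predT -> minormx S M = M.
Proof. by move=> S0; apply/matrixP => k l; rewrite !mxE !S0. Qed.

(** * Determinant of a sum of blocks placed along an injective labelling *)

Section BlockSum.
Variables (I T : finType) (n : T -> nat) (pos : I -> {t : T & 'I_(n t)}).
Hypothesis pos_inj : injective pos.

(** Incidence matrix between the positions of block [t] and the labels placed there; conjugating by
    it transports a matrix on positions to one on labels. *)
Definition posmx t : 'M[K]_(n t, #|I|) :=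
  \matrix_(k, j) (pos (enum_val j) == Tagged (fun t => 'I_(n t)) k)%:R.

Definition posd t : pred 'I_(n t) := fun k => Tagged (fun t => 'I_(n t)) k \in codom pos.

Lemma posmx_orth t u : t != u -> posmx t *m (posmx u)^T = 0.
Proof.
move=> tu; apply/matrixP => k l; rewrite !mxE big1 // => j _; rewrite !mxE.
case: eqP => [->|]; last by rewrite mul0r.
case: eqP => [e|]; last by rewrite mulr0.
by move/(congr1 tag): e tu => /= ->; rewrite eqxx.
Qed.

Lemma posmx_sum : \sum_t (posmx t)^T *m posmx t = 1%:M.
Proof.
apply/matrixP => i j; rewrite summxE !mxE.
case E: (pos (enum_val i)) => [t k].
rewrite (bigD1 t) //= [X in _ + X]big1 ?addr0 => [|u ut]; last first.
  rewrite mxE big1 // => l _; rewrite !mxE E; case: eqP => [/(congr1 tag)/= e|].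
    by rewrite e eqxx in ut.
  by rewrite mul0r.
rewrite mxE (bigD1 k) //= [X in _ + X]big1 ?addr0 => [|l lk]; last first.
  by rewrite !mxE E eq_Tagged /= eq_sym (negbTE lk) mul0r.
rewrite !mxE E eqxx mul1r /Tagged -E (inj_eq pos_inj) (inj_eq enum_val_inj).
by rewrite eq_sym.
Qed.

Lemma posmx_off t k j : ~~ posd k -> posmx t k j = 0.
Proof. by move=> h; rewrite mxE; case: eqP => // e; case/negP: h; rewrite /posd -e codom_f. Qed.

(** Up to a permutation the sum is block diagonal. It is written as 1 plus mutually annihilating
    terms, and Sylvester's identity moves the determinant of each factor from labels to
    positions. *)
Lemma det_block_sum (B : forall t, 'M[K]_(n t)) :
  \det (\sum_t (posmx t)^T *m B t *m posmx t) = \prod_t \det (minormx (@posd t) (B t)).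
Proof.
pose X t := minormx (@posd t) (B t) - 1%:M.
pose E t := (posmx t)^T *m X t *m posmx t.
have -> : \sum_t (posmx t)^T *m B t *m posmx t = 1%:M + \sum_t E t.
  rewrite -posmx_sum -big_split /=; apply: eq_bigr => t _.
  rewrite /E /X mulmxBr mulmxBl mulmx1 addrC subrK.
  apply/matrixP => i j; rewrite !mxE; apply: eq_bigr => l _.
  rewrite [(_ *m B t) i l]mxE [(_ *m minormx _ _) i l]mxE; case Sl: (posd l);
    last by rewrite posmx_off ?Sl // !mulr0.
  congr (_ * _); apply: eq_bigr => k _.
  rewrite [minormx _ _ _ _]mxE Sl andbT; case Sk: (posd k) => //.
  by rewrite ![(posmx t)^T i k]mxE posmx_off ?Sk // !mul0r.
rewrite det_add1_sum ?index_enum_uniq // => [|t u tu]; last first.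
  by rewrite /E !mulmxA -[_ *m posmx t *m _]mulmxA posmx_orth // mulmx0 !mul0mx.
apply: eq_bigr => t _; rewrite /E -mulmxA det_add1_mulmxC -mulmxA; congr (\det _).
rewrite -[RHS](addrNK 1%:M) -/(X t) addrC; congr (_ + _).
apply/matrixP => k l; rewrite [LHS]mxE (bigD1 l) //= big1 ?addr0 => [|j jl].
  have [/codomP[c ec]|Sl] := boolP (posd l); last first.
    by rewrite !mxE (negbTE Sl) andbF subrr mul0r.
  rewrite [X in _ * X]mxE (bigD1 (enum_rank c)) //= big1 ?addr0 => [|i ic].
    by rewrite !mxE enum_rankK -ec eqxx !mulr1.
  rewrite !mxE ec (inj_eq pos_inj); case: eqP => [e|]; last by rewrite mul0r.
  by rewrite -e enum_valK eqxx in ic.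
rewrite [X in _ * X]mxE big1 ?mulr0 // => i _; rewrite !mxE.
case: eqP => [->|]; last by rewrite mul0r.
by rewrite eq_Tagged /= (negbTE jl) mulr0.
Qed.

End BlockSum.

(** * Block triangular matrices and their corner minors *)

Section LeadTrail.
Variable n : nat.
Implicit Types (s : nat) (M T : 'M[K]_n).

Definition leadmx s M := minormx (fun k : 'I_n => k < s)%N M.
Definition trailmx s M := minormx (fun k : 'I_n => s <= k)%N M.

Definition block_lower s T := forall k l : 'I_n, (k < s)%N -> (s <= l)%N -> T k l = 0.

Lemma leadmxE s M k l :
  leadmx s M k l = if (k < s)%N && (l < s)%N then M k l else (k == l)%:R.
Proof. exact: mxE. Qed.

Lemma trailmxE s M k l :
  trailmx s M k l = if (s <= k)%N && (s <= l)%N then M k l else (k == l)%:R.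
Proof. exact: mxE. Qed.

(** The first [s] rows of [T] vanish from column [s] on, so the leading block of the product
    involves leading blocks only. *)
Lemma leadmxM s T M : block_lower s T -> leadmx s (T *m M) = leadmx s T *m leadmx s M.
Proof.
move=> hT; apply/matrixP => k l; rewrite [RHS]mxE leadmxE [(_ *m _) k l]mxE.
have [ks|sk] := ltnP k s; last first.
  have e j : leadmx s T k j = (k == j)%:R by rewrite leadmxE ltnNge sk.
  rewrite /= (bigD1 k) //= e eqxx mul1r leadmxE [(k < s)%N]ltnNge sk /= big1 ?addr0 // => j jk.
  by rewrite e eq_sym (negbTE jk) mul0r.
have [ls|sl] := ltnP l s => /=; last first.
  have e j : leadmx s M j l = (j == l)%:R by rewrite leadmxE [(l < s)%N]ltnNge sl andbF.
  rewrite /= (bigD1 l) //= e eqxx mulr1 leadmxE [(l < s)%N]ltnNge sl andbF /=.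
  rewrite big1 ?addr0 // => j jl; by rewrite e (negbTE jl) mulr0.
apply: eq_bigr => j _; rewrite !leadmxE ks ls andbT; have [js|sj] := ltnP j s => //=.
rewrite hT // mul0r; case: eqP => [kj|]; last by rewrite mul0r.
by move: sj; rewrite -kj leqNgt ks.
Qed.

Lemma det_unitrig M (S : pred 'I_n) :
  (forall k l : 'I_n, (k <= l)%N -> M k l = (k == l)%:R) -> \det (minormx S M) = 1.
Proof.
move=> h; rewrite det_trig ?big1 // => [k _|]; first by rewrite mxE h // eqxx if_same.
apply/is_trig_mxP => k l kl; rewrite mxE h 1?ltnW //.
by case: eqP => [e|]; [move: kl; rewrite e ltnn | rewrite if_same].
Qed.

Lemma det_block_lower s T : block_lower s T ->
  \det T = \det (leadmx s T) * \det (trailmx s T).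
Proof.
(* [Y] carries the lower left block: [[[A, 0], [C, D]]] is the product of [diag(A, 1)], [[[1, 0],
   [C, 1]]] and [diag(1, D)]. *)
move=> hT; pose Y : 'M[K]_n := \matrix_(k, l)
  if (s <= k)%N && (l < s)%N then T k l else (k == l)%:R.
have Y1 (S : pred 'I_n) : \det (minormx S Y) = 1.
  apply: det_unitrig => k l kl; rewrite mxE; case: andP => // -[sk ls].
  by move: (leq_trans sk kl); rewrite leqNgt ls.
have := Y1 predT; rewrite minormxT // => {Y1} Y1.
have {1}-> : T = leadmx s T *m Y *m trailmx s T; last by rewrite !det_mulmx Y1 mulr1.
have GE k l : (leadmx s T *m Y) k l = if (k < s)%N then leadmx s T k l else Y k l.
  rewrite mxE; case: ltnP => [ks|sk].
    rewrite (bigD1 l) //= big1 ?addr0 => [|j jl].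
      rewrite [Y _ _]mxE eqxx; case: andP => [[sl _]|]; last by rewrite mulr1.
      rewrite leadmxE ks [(l < s)%N]ltnNge sl /=.
      case: eqP => [kl|]; last by rewrite mul0r.
      by move: sl; rewrite -kl leqNgt ks.
    have [js|sj] := ltnP j s.
      by rewrite [Y _ _]mxE leqNgt js (negbTE jl) mulr0.
    rewrite leadmxE ks [(j < s)%N]ltnNge sj /=.
    case: eqP => [kj|]; last by rewrite mul0r.
    by move: sj; rewrite -kj leqNgt ks.
  rewrite (bigD1 k) //= big1 ?addr0 => [|j jk]; rewrite leadmxE [(k < s)%N]ltnNge sk /=.
    by rewrite eqxx mul1r.
  by rewrite eq_sym (negbTE jk) mul0r.
apply/matrixP => k l; rewrite mxE; have [ls|sl] := ltnP l s.
  rewrite (bigD1 l) //= big1 ?addr0 => [|j jl].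
    rewrite GE trailmxE [(s <= l)%N]leqNgt ls /= eqxx mulr1 leadmxE [Y _ _]mxE ls !andbT.
    by case: ltnP.
  by rewrite trailmxE [(s <= l)%N]leqNgt ls andbF (negbTE jl) mulr0.
have [ks|sk] := ltnP k s.
  rewrite hT // big1 // => j _; rewrite GE ks leadmxE trailmxE ks sl /= andbT.
  have [js|sj] /= := ltnP j s;
    last by case: eqP => [kj|]; rewrite ?mul0r //; move: sj; rewrite -kj; lia.
  by case: eqP => [jl|]; rewrite ?mulr0 //; move: js; rewrite jl; lia.
rewrite (bigD1 k) //= big1 ?addr0 => [|j jk].
  rewrite GE ltnNge sk /= trailmxE [Y _ _]mxE sk sl /= eqxx [(k < s)%N]ltnNge sk /=.
  by rewrite mul1r.
rewrite GE ltnNge sk /= trailmxE [Y _ _]mxE sk sl /= andbT; have [js|sj] := ltnP j s.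
  by case: (j =P l) => [e|]; rewrite ?mulr0 //; move: js; rewrite e; lia.
by rewrite eq_sym (negbTE jk) mul0r.
Qed.

End LeadTrail.
End Determinants.

Section BlockSumAction.
Variables (K : comNzRingType) (I T : finType) (n : T -> nat).
Variable pos : I -> {t : T & 'I_(n t)}.
Hypothesis pos_inj : injective pos.
Local Notation posmx := (posmx K pos).

Lemma mul_trposmx (w : 'rV[K]_#|I|) c t k : pos c = Tagged (fun t => 'I_(n t)) k ->
  (w *m (posmx t)^T) 0 k = w 0 (enum_rank c).
Proof.
move=> e; rewrite mxE (bigD1 (enum_rank c)) //= big1 ?addr0 => [|i ic].
  by rewrite !mxE enum_rankK e eqxx mulr1.
rewrite !mxE -e (inj_eq pos_inj); case: eqP => [e'|]; last by rewrite mulr0.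
by rewrite -e' enum_valK eqxx in ic.
Qed.

Lemma mul_trposmx_off (w : 'rV[K]_#|I|) t (k : 'I_(n t)) :
  ~~ posd pos k -> (w *m (posmx t)^T) 0 k = 0.
Proof.
by move=> h; rewrite mxE big1 // => i _; rewrite [_^T _ _]mxE posmx_off // mulr0.
Qed.

Lemma mul_block_sum (w : 'rV[K]_#|I|) (B : forall t, 'M[K]_(n t)) c t k :
  pos c = Tagged (fun t => 'I_(n t)) k ->
  (w *m \sum_u (posmx u)^T *m B u *m posmx u) 0 (enum_rank c) =
  (w *m (posmx t)^T *m B t) 0 k.
Proof.
move=> e; rewrite mulmx_sumr summxE (bigD1 t) //= big1 ?addr0 => [|u ut].
  rewrite !mulmxA mxE (bigD1 k) //= big1 ?addr0 => [|l lk].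
    by rewrite [posmx _ _ _]mxE enum_rankK e eqxx mulr1.
  by rewrite [posmx _ _ _]mxE enum_rankK e eq_Tagged /= eq_sym (negbTE lk) mulr0.
rewrite mulmxA mxE big1 // => l _; rewrite [posmx _ _ _]mxE enum_rankK e.
by case: eqP => [/(congr1 tag)/= tu|]; [rewrite tu eqxx in ut | rewrite mulr0].
Qed.

End BlockSumAction.

(** * Multiplication operators on families of matrices with prescribed support *)

Section SparseFamilies.
Variables (K : comNzRingType) (E : finType) (m n : E -> nat).
Variable P : pred {e : E & ('I_(m e) * 'I_(n e))%type}.
(** [P] is the support pattern. The fibres of W and the tangent spaces of the flag product are both
    of this form, so the same determinant formulas serve det W and K_F. *)
Definition scoord := {c : {e : E & ('I_(m e) * 'I_(n e))%type} | P c}.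
Local Notation N := #|{: scoord}|.
Local Notation cell e k l := (existT (fun i => ('I_(m i) * 'I_(n i))%type) e (k, l)).

Definition smx (w : 'rV[K]_N) e : 'M[K]_(m e, n e) :=
  \matrix_(k, l) if (insub (cell e k l) : option scoord) is Some c
                 then w 0 (enum_rank c) else 0.

Lemma smx_val w (c : scoord) :
  smx w (tag (val c)) (tagged (val c)).1 (tagged (val c)).2 = w 0 (enum_rank c).
Proof.
case: c => -[e [k l]] h; rewrite mxE /=; case: insubP => [c' _ /= ec'|]; last by rewrite h.
by congr (w 0 (enum_rank _)); apply: val_inj.
Qed.

Lemma smx_off w e k l : ~~ P (cell e k l) -> smx w e k l = 0.
Proof. by move=> h; rewrite mxE insubN. Qed.

Lemma smxP (w : 'rV[K]_N) (X : forall e, 'M[K]_(m e, n e)) :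
  (forall e k l, ~~ P (cell e k l) -> X e k l = 0) ->
  (forall c : scoord, w 0 (enum_rank c) = X (tag (val c)) (tagged (val c)).1 (tagged (val c)).2) ->
  forall e, smx w e = X e.
Proof.
move=> X0 wX e; apply/matrixP => k l.
have [h|h] := boolP (P (cell e k l)); last by rewrite smx_off ?X0.
by have := smx_val w (Sub (cell e k l) h); rewrite wX /= => ->.
Qed.

(** Right multiplication acts on each row separately, so the blocks are the rows [(e, k)] and [l] is
    the position in the block; for left multiplication, [lpos] takes the columns as blocks. *)
Definition rpos (c : scoord) : {t : {e : E & 'I_(m e)} & 'I_(n (tag t))} :=
  existT (fun t : {e : E & 'I_(m e)} => 'I_(n (tag t)))
    (existT (fun e => 'I_(m e)) (tag (val c)) (tagged (val c)).1) (tagged (val c)).2.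

Definition lpos (c : scoord) : {t : {e : E & 'I_(n e)} & 'I_(m (tag t))} :=
  existT (fun t : {e : E & 'I_(n e)} => 'I_(m (tag t)))
    (existT (fun e => 'I_(n e)) (tag (val c)) (tagged (val c)).2) (tagged (val c)).1.

Definition rpos_cell (t : {t : {e : E & 'I_(m e)} & 'I_(n (tag t))}) :=
  cell (tag (tag t)) (tagged (tag t)) (tagged t).

Definition lpos_cell (t : {t : {e : E & 'I_(n e)} & 'I_(m (tag t))}) :=
  cell (tag (tag t)) (tagged t) (tagged (tag t)).

Lemma rposK c : rpos_cell (rpos c) = val c. Proof. by case: c => -[e [k l]]. Qed.
Lemma lposK c : lpos_cell (lpos c) = val c. Proof. by case: c => -[e [k l]]. Qed.

Lemma rpos_inj : injective rpos.
Proof. by move=> c c' /(congr1 rpos_cell); rewrite !rposK => /val_inj. Qed.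
Lemma lpos_inj : injective lpos.
Proof. by move=> c c' /(congr1 lpos_cell); rewrite !lposK => /val_inj. Qed.

Lemma rposd e (k : 'I_(m e)) (l : 'I_(n e)) :
  posd rpos (t := Tagged (fun e => 'I_(m e)) k) l = P (cell e k l).
Proof.
apply/codomP/idP => [[c /(congr1 rpos_cell)]|h]; last by exists (Sub (cell e k l) h).
by rewrite rposK /rpos_cell /= => ->; apply: valP.
Qed.

Lemma lposd e (k : 'I_(m e)) (l : 'I_(n e)) :
  posd lpos (t := Tagged (fun e => 'I_(n e)) l) k = P (cell e k l).
Proof.
apply/codomP/idP => [[c /(congr1 lpos_cell)]|h]; last by exists (Sub (cell e k l) h).
by rewrite lposK /lpos_cell /= => ->; apply: valP.
Qed.

(** The operator [X e |-> X e *m B e] on coordinates, with the entries that fall outside [P]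
    discarded. Its analogue [lmulmx] has a transpose because coordinates are row vectors. *)
Definition rmulmx (B : forall e, 'M[K]_(n e)) : 'M[K]_N :=
  \sum_t (posmx K rpos t)^T *m B (tag t) *m posmx K rpos t.

Definition lmulmx (A : forall e, 'M[K]_(m e)) : 'M[K]_N :=
  \sum_t (posmx K lpos t)^T *m (A (tag t))^T *m posmx K lpos t.

Lemma smx_rpos w e (k : 'I_(m e)) (l : 'I_(n e)) :
  (w *m (posmx K rpos (Tagged (fun e => 'I_(m e)) k))^T) 0 l = smx w e k l.
Proof.
have [h|h] := boolP (P (cell e k l)); last by rewrite mul_trposmx_off ?rposd ?smx_off.
rewrite (@mul_trposmx _ _ _ _ _ rpos_inj _ (Sub (cell e k l) h)) //.
by rewrite -smx_val.
Qed.

Lemma smx_lpos w e (k : 'I_(m e)) (l : 'I_(n e)) :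
  (w *m (posmx K lpos (Tagged (fun e => 'I_(n e)) l))^T) 0 k = smx w e k l.
Proof.
have [h|h] := boolP (P (cell e k l)); last by rewrite mul_trposmx_off ?lposd ?smx_off.
rewrite (@mul_trposmx _ _ _ _ _ lpos_inj _ (Sub (cell e k l) h)) //.
by rewrite -smx_val.
Qed.

Lemma mul_rmulmx w B (c : scoord) : (w *m rmulmx B) 0 (enum_rank c) =
  (smx w (tag (val c)) *m B (tag (val c))) (tagged (val c)).1 (tagged (val c)).2.
Proof.
rewrite (@mul_block_sum _ _ _ _ _ w (fun t => B (tag t)) c _ (tagged (rpos c))) //=.
rewrite [LHS]mxE [RHS]mxE.
by apply: eq_bigr => j _; rewrite smx_rpos.
Qed.

Lemma mul_lmulmx w A (c : scoord) : (w *m lmulmx A) 0 (enum_rank c) =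
  (A (tag (val c)) *m smx w (tag (val c))) (tagged (val c)).1 (tagged (val c)).2.
Proof.
rewrite (@mul_block_sum _ _ _ _ _ w (fun t => (A (tag t))^T) c _ (tagged (lpos c))) //=.
rewrite [LHS]mxE [RHS]mxE.
by apply: eq_bigr => j _; rewrite smx_lpos [X in _ * X]mxE mulrC.
Qed.

(** Each row [k] of [e] is a block, on which [B e] acts through the columns that [P] allows in that
    row. *)
Lemma det_rmulmx B : \det (rmulmx B) =
  \prod_e \prod_k \det (minormx (fun l => P (cell e k l)) (B e)).
Proof.
rewrite (@det_block_sum _ _ _ _ _ rpos_inj (fun t => B (tag t))).
rewrite (@sig_big_dep _ _ _ _ (fun e => 'I_(m e)) xpredT (fun _ _ => true)
  (fun e k => \det (minormx (fun l => P (cell e k l)) (B e)))).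
apply: eq_bigr => -[e k] _ /=; congr (\det _).
by apply/matrixP => i j; rewrite !mxE !rposd.
Qed.

Lemma det_lmulmx A : \det (lmulmx A) =
  \prod_e \prod_l \det (minormx (fun k => P (cell e k l)) (A e)).
Proof.
rewrite (@det_block_sum _ _ _ _ _ lpos_inj (fun t => (A (tag t))^T)).
rewrite (@sig_big_dep _ _ _ _ (fun e => 'I_(n e)) xpredT (fun _ _ => true)
  (fun e l => \det (minormx (fun k => P (cell e k l)) (A e)))).
apply: eq_bigr => -[e k] _ /=; rewrite -[RHS]det_tr tr_minormx; congr (\det _).
by apply/matrixP => i j; rewrite !mxE !lposd.
Qed.

End SparseFamilies.

(** * The transition function of det W *)

Lemma prod_ord_blocks (K : comNzRingType) (n a b : nat) (X Y Z : K) : (a <= b <= n)%N ->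
  \prod_(k < n) (if (k < a)%N then X else if (k < b)%N then Y else Z) =
  X ^+ a * Y ^+ (b - a) * Z ^+ (n - b).
Proof.
case/andP=> ab bn.
rewrite -(big_mkord predT (fun k => if (k < a)%N then X else if (k < b)%N then Y else Z)).
rewrite (@big_cat_nat _ _ _ b) //= (@big_cat_nat _ _ _ a 0%N b) //=; congr (_ * _ * _).
- rewrite big_nat (eq_bigr (fun=> X)) => [|k /andP[_ ->] //].
  by rewrite -big_nat prodr_const_nat subn0.
- rewrite big_nat (eq_bigr (fun=> Y)) => [|k /andP[ak ->]]; last by rewrite ltnNge ak.
  by rewrite -big_nat prodr_const_nat.
rewrite big_nat (eq_bigr (fun=> Z)) => [|k /andP[bk _]].
  by rewrite -big_nat prodr_const_nat.
by rewrite !ltnNge bk (leq_trans ab bk).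
Qed.

Lemma invmx_mul (K : fieldType) k (A B : 'M[K]_k) : A \in unitmx -> B \in unitmx ->
  invmx (A *m B) = invmx B *m invmx A.
Proof.
move=> uA uB; apply: (can_inj (mulKmx (_ : A *m B \in unitmx))); first by rewrite unitmx_mul uA.
by rewrite mulmxV ?unitmx_mul ?uA // mulmxA mulmxK // mulmxV.
Qed.

Lemma eq_mulrV (K : comNzRingType) n k (A B : 'M[K]_(n, k)) :
  (forall w : 'rV_n, w *m A = w *m B) -> A = B.
Proof. by move=> h; apply/row_matrixP => i; rewrite !rowE h. Qed.

(** * Transition matrices between adapted bases *)

Section Transition.
Variables (K : numFieldType) (I : finType) (n a b : I -> nat).
Hypothesis hab : forall v, (a v <= b v <= n v)%N.
Local Notation F := (flag_atlas K hab).
Local Notation fchart := (@chart K F).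
Local Notation bas := (bases K n).
Implicit Types (g h : bas) (x y : 'rV[K]_(fdim n a b)).

Definition transmx g h x y v : 'M[K]_(n v) := adapted g x v *m invmx (adapted h y v).

(* The leading minor of [transmx], which does not depend on the chart h beyond its
   basis, see [det_leadmx_trans]: the transition function of det U for rank U = s. *)
Definition chart_minor g h x v s : K := \det (leadmx s (adapted g x v *m invmx (sval h v))).

Definition basis_ratio g h v : K := \det (sval g v) / \det (sval h v).

Lemma transmx_unit g h x y v : transmx g h x y v \in unitmx.
Proof. by rewrite unitmx_mul unitmx_inv !adapted_unit. Qed.

Lemma transmxV g h x y v : invmx (transmx g h x y v) = transmx h g y x v.
Proof.
apply: (can_inj (mulmxK (transmx_unit g h x y v))); rewrite mulVmx ?transmx_unit //.
by rewrite /transmx mulmxA mulmxKV ?adapted_unit // mulmxV ?adapted_unit.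
Qed.

(** Equal flags put the first [s] rows of one adapted basis in the span of the first [s] rows of the
    other. *)
Lemma transmx_lower g h x y v s : fchart g x = fchart h y -> s = a v \/ s = b v ->
  block_lower s (transmx g h x y v).
Proof.
move=> /flag_chart_eq e hs k l ks sl.
have := row_rowspan (adapted g x v) ks; rewrite e // => /(rowspanP _ _ (adapted_unit h y v)).
by move=> /(_ l sl); rewrite -row_mul mxE.
Qed.

Lemma transmx_chart g h x y :
  (forall v s, s = a v \/ s = b v -> block_lower s (transmx g h x y v)) ->
  fchart g x = fchart h y.
Proof.
move=> T0; apply/flag_chart_eq => v s hs.
have sn : (s <= n v)%N by have := hab v; case: hs => ->; lia.
apply/eqP; rewrite eqEdim !dim_rowspan ?adapted_unit // leqnn andbT.
apply: rowspan_sub => k ks; apply/rowspanP; first exact: adapted_unit.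
by move=> l sl; rewrite -row_mul mxE (T0 v s hs).
Qed.

Lemma unip_le x v (k l : 'I_(n v)) : (l <= k)%N -> unip x v k l = (k == l)%:R.
Proof. by move=> lk; rewrite unip_lower //; apply: blk_mono. Qed.

Lemma det_minormx_unip x v (S : pred 'I_(n v)) : \det (minormx S (unip x v)) = 1.
Proof.
rewrite -det_tr tr_minormx; apply: det_unitrig => k l kl.
by rewrite mxE unip_le // eq_sym.
Qed.

(** Multiplying the transition matrix by [unip y v] on the right removes [y] from it, and changes no
    leading minor since those of [unip y v] are 1. *)
Lemma det_leadmx_trans g h x y v s : fchart g x = fchart h y -> s = a v \/ s = b v ->
  \det (leadmx s (transmx g h x y v)) = chart_minor g h x v s.
Proof.
move=> e hs; have := leadmxM (unip y v) (transmx_lower e hs).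
move/(congr1 determinant); rewrite det_mulmx [X in _ = _ * X]det_minormx_unip mulr1 => <-.
congr (\det (leadmx s _)).
rewrite /transmx -mulmxA; congr (_ *m _).
apply: (can_inj (mulmxK (svalP h v))); rewrite [RHS]mulVmx ?(svalP h v) //.
by rewrite -mulmxA mulVmx // adapted_unit.
Qed.

Lemma det_transmx g h x y v : \det (transmx g h x y v) = basis_ratio g h v.
Proof. by rewrite det_mulmx det_inv !det_mulmx !det_unip !mul1r. Qed.

Lemma basis_ratio_neq0 g h v : basis_ratio g h v != 0.
Proof. by rewrite mulf_neq0 ?invr_eq0 // -unitfE -unitmxE ?(svalP g) ?(svalP h). Qed.

(** The two diagonal blocks act on the subspace and on the quotient; this expresses the determinant
    on [V/U] through the one on [U]. *)
Lemma chart_minor_trail g h x y v s : fchart g x = fchart h y -> s = a v \/ s = b v ->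
  basis_ratio g h v = chart_minor g h x v s * \det (trailmx s (transmx g h x y v)).
Proof.
move=> e hs; rewrite -(det_transmx g h x y).
by rewrite (det_block_lower (transmx_lower e hs)) (det_leadmx_trans e hs).
Qed.

Lemma chart_minor_neq0 g h x y v s : fchart g x = fchart h y -> s = a v \/ s = b v ->
  chart_minor g h x v s != 0.
Proof.
move=> e hs; have := basis_ratio_neq0 g h v.
by rewrite (chart_minor_trail e hs) mulf_eq0 negb_or => /andP[].
Qed.

Lemma det_trailmx_trans g h x y v s : fchart g x = fchart h y -> s = a v \/ s = b v ->
  \det (trailmx s (transmx g h x y v)) = basis_ratio g h v / chart_minor g h x v s.
Proof.
by move=> e hs; rewrite (chart_minor_trail e hs) mulrC mulKf // (chart_minor_neq0 e hs).
Qed.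

Lemma chart_minorV g h x y v s : fchart g x = fchart h y -> s = a v \/ s = b v ->
  chart_minor h g y v s = (chart_minor g h x v s)^-1.
Proof.
move=> e hs; rewrite -(det_leadmx_trans (esym e) hs) -(det_leadmx_trans e hs) -transmxV.
apply: (mulfI (chart_minor_neq0 e hs)); rewrite -(det_leadmx_trans e hs).
rewrite -det_mulmx -leadmxM; last exact: transmx_lower.
rewrite mulmxV ?transmx_unit // [leadmx _ _]minormx1 det1 divff //.
by rewrite (det_leadmx_trans e hs) (chart_minor_neq0 e hs).
Qed.

Lemma basis_ratioV g h v : basis_ratio h g v = (basis_ratio g h v)^-1.
Proof. by rewrite invf_div. Qed.

Lemma coord_changeE g h x y : fchart g x = fchart h y -> coord_change (X := F) g h x = y.
Proof.
move=> e; apply: (@chart_inj _ F h); rewrite -e.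
apply: (@xgetPex _ 0 [set y | fchart h y = fchart g x]%classic).
by exists y.
Qed.

End Transition.

Section DetW.
Variables (K : numFieldType) (m : nat) (d : nat -> nat) (a b : 'I_m.*2.+1 -> nat).
Hypothesis hab : forall v, (a v <= b v <= vdim d v)%N.
Local Notation F := (flag_atlas K hab).
Local Notation fchart := (@chart K F).

Lemma part_dim_or (e : arrow m) v : part_dim a b e v = a v \/ part_dim a b e v = b v.
Proof. by rewrite /part_dim; case: e.2; [right|left]. Qed.

Lemma part_dim_le (e : arrow m) v : (part_dim a b e v <= vdim d v)%N.
Proof. by have := hab v; case: (part_dim_or e v) => ->; lia. Qed.

Definition W_pred (c : rep_coord m d) : bool :=
  (part_dim a b (tag c) (source (tag c)) <= (tagged c).1)%N &&
  ((tagged c).2 < part_dim a b (tag c) (target (tag c)))%N.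

Lemma W_coef_smx (w : 'rV[K]_(W_rank d a b)) e : W_coef w e = smx (P := W_pred) w e.
Proof. by apply/matrixP => k l; rewrite W_coefE mxE. Qed.

(** By block triangularity both multiplications preserve the pattern [W_pred], so the operators
    restricted to the pattern compute the full matrix products. *)
Lemma W_frame_trans (g h : bases K (vdim d)) x y : fchart g x = fchart h y ->
  W_frame g x = rmulmx W_pred (fun e => transmx g h x y (target e)) *m
    lmulmx W_pred (fun e => transmx h g y x (source e)) *m W_frame h y.
Proof.
move=> e; apply: eq_mulrV => w; apply: rep_mapI => f.
have ds f' v : part_dim a b f' v = a v \/ part_dim a b f' v = b v := part_dim_or f' v.
rewrite !mulmxA !rep_map_frame !W_coef_smx.
pose X f := smx (P := W_pred) w f *m transmx g h x y (target f).
have Xk f' (k : 'I_(vdim d (source f'))) (l : 'I_(vdim d (target f'))) :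
    (k < part_dim a b f' (source f'))%N -> X f' k l = 0.
  move=> ks; rewrite mxE big1 // => j _.
  by rewrite (@smx_off _ _ _ _ W_pred) ?mul0r // /W_pred /= leqNgt ks.
have Xl f' (k : 'I_(vdim d (source f'))) (l : 'I_(vdim d (target f'))) :
    (part_dim a b f' (target f') <= l)%N -> X f' k l = 0.
  move=> sl; rewrite mxE big1 // => j _; have [js|sj] := ltnP j (part_dim a b f' (target f')).
    by rewrite [transmx _ _ _ _ _ _ _](transmx_lower e (ds f' _)) // mulr0.
  by rewrite (@smx_off _ _ _ _ W_pred) ?mul0r // /W_pred /= ltnNge sj andbF.
have X0 (f' : arrow m) k l : ~~ W_pred (existT _ f' (k, l)) -> X f' k l = 0.
  by rewrite negb_and -ltnNge -leqNgt /= => /orP[/Xk|/Xl].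
have -> : smx (P := W_pred)
    (w *m rmulmx W_pred (fun e => transmx g h x y (target e)) *m
       lmulmx W_pred (fun e => transmx h g y x (source e))) f =
    transmx h g y x (source f) *m X f.
  apply: (@smxP _ _ _ _ W_pred _ (fun f => transmx h g y x (source f) *m X f)) => [f' k l|c].
    rewrite negb_and -ltnNge -leqNgt /= => /orP[ks|sl]; rewrite mxE big1 // => j _.
      have [sj|js] := leqP (part_dim a b f' (source f')) j; last by rewrite Xk ?mulr0.
      by rewrite [transmx _ _ _ _ _ _ _](transmx_lower (esym e) (ds f' _)) // mul0r.
    by rewrite Xl ?mulr0.
  rewrite mul_lmulmx; congr ((_ *m _) _ _).
  apply: (@smxP _ _ _ _ W_pred _ X X0) => c'; exact: mul_rmulmx.
rewrite /X /transmx; set B := adapted h y (source f); set B' := adapted h y (target f).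
have: B' \in unitmx by apply: adapted_unit.
have: B \in unitmx by apply: adapted_unit.
move: B B' (adapted g x (source f)) (adapted g x (target f)) (smx _ _) => B B' A A' C uB uB'.
by rewrite !mulmxA mulVmx // mul1mx mulmxKV.
Qed.

(** Each row index outside [U_s] contributes the leading minor at the target, and each column index
    inside [U_t] the trailing minor of the inverse transition matrix at the source. *)
Lemma det_WE (g h : bases K (vdim d)) x y : fchart g x = fchart h y ->
  det_bundle (W_bundle K hab) g h x =
  \prod_(e : arrow m)
    (chart_minor g h x (target e) (part_dim a b e (target e))
       ^+ (vdim d (source e) - part_dim a b e (source e)) *
     (chart_minor g h x (source e) (part_dim a b e (source e)) /
        basis_ratio g h (source e)) ^+ part_dim a b e (target e)).
Proof.
move=> e; rewrite /det_bundle (coord_changeE e) /= (W_frame_trans e).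
rewrite -[_ *m W_frame h y *m _]mulmxA mulmxVp ?W_frame_free // mulmx1.
rewrite det_mulmx det_rmulmx det_lmulmx -big_split /=.
apply: eq_bigr => f _; congr (_ * _).
  rewrite -(det_leadmx_trans e (part_dim_or f _)).
  have := prod_ord_blocks 1
    (\det (leadmx (part_dim a b f (target f)) (transmx g h x y (target f)))) 1
    (n := vdim d (source f)) (a := part_dim a b f (source f))
    (b := vdim d (source f)).
  rewrite part_dim_le leqnn !expr1n mul1r mulr1 => <- //; apply: eq_bigr => k _.
  rewrite ltn_ord; case: ltnP => sk.
    by rewrite minormx0 ?det1 // => l; rewrite /W_pred /= leqNgt sk.
  by congr (\det _); apply/matrixP => i j; rewrite leadmxE mxE /W_pred /= sk.
rewrite -[_ / _]invf_div -(det_trailmx_trans e (part_dim_or f _)).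
have -> : (\det (trailmx (part_dim a b f (source f)) (transmx g h x y (source f))))^-1 =
  \det (trailmx (part_dim a b f (source f)) (transmx h g y x (source f))).
  rewrite (det_trailmx_trans e (part_dim_or f _)) (det_trailmx_trans (esym e) (part_dim_or f _)).
  by rewrite (chart_minorV e (part_dim_or f _)) (basis_ratioV g h) invf_div invrK mulrC.
have := prod_ord_blocks
  (\det (trailmx (part_dim a b f (source f)) (transmx h g y x (source f)))) 1 1
  (n := vdim d (target f)) (a := part_dim a b f (target f))
  (b := part_dim a b f (target f)).
rewrite part_dim_le leqnn !expr1n !mulr1 => <- //; apply: eq_bigr => k _.
case: ltnP => sk; last by rewrite minormx0 ?det1 // => l; rewrite andbF.
by congr (\det _); apply/matrixP => i j; rewrite trailmxE mxE !andbT.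
Qed.

End DetW.

(** * The Jacobian of a change of charts *)

Section Calculus.
Variable K : numFieldType.
Local Open Scope classical_set_scope.

(** Serves to transfer differentiability to [coord_change], which is only known to agree with a
    rational map near a point. *)
Lemma near_eq_differentiable (V W : normedModType K) (f g : V -> W) (x : V) :
  {near x, f =1 g} -> differentiable f x -> differentiable g x.
Proof.
move=> fg df.
have : g \o shift x = cst (g x) + 'd f x +o_ 0 id.
  have := diff_locally df => /eqaddoP dfx; apply/eqaddoP => e e0; have := dfx e e0.
  rewrite -(nbhs_singleton fg); apply: filter_app.
  have nfg : \forall z \near 0, f (z + x) = g (z + x).
    by move: fg; rewrite (near_shift 0) subr0.
  by near=> z; rewrite !fctE /= (near nfg z).
move=> dg; have dE := diff_unique (diff_continuous df) dg.
by apply/diff_locallyP; rewrite dE; split => //; apply: diff_continuous.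
Unshelve. all: by end_near. Qed.

Lemma diff_coord m n (M u : 'M[K]_(m, n)) i j :
  'd (fun N : 'M[K]_(m, n) => N i j : K) M u = u i j.
Proof.
have clin : linear (fun N : 'M[K]_(m, n) => N i j : K) by move=> c A B; rewrite !mxE.
pose clM := GRing.isLinear.Build _ _ _ _ _ clin.
pose f : {linear 'M[K]_(m, n) -> K} := HB.pack (fun N : 'M[K]_(m, n) => N i j : K) clM.
by rewrite (@diff_lin _ _ _ f) //; apply: coord_continuous.
Qed.

Lemma derive_coord (V : normedModType K) m n (f : V -> 'M[K]_(m, n)) x u i j :
  differentiable f x -> 'D_u (fun z => f z i j : K) x = ('D_u f x) i j.
Proof.
move=> df; have dc := differentiable_coord (f x) i j.
rewrite !deriveE //; last exact: (differentiable_comp df dc).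
by rewrite (diff_comp df dc) /= diff_coord.
Qed.

Lemma polyfun_differentiable n (f : 'rV[K]_n -> K) x : polyfun f -> differentiable f x.
Proof.
case=> P fP; have -> : f = fun x => meval (fun k => x 0 k) P by apply/funext.
have dM (g h : 'rV[K]_n -> K) : differentiable g x -> differentiable h x ->
    differentiable (fun z => g z * h z) x by apply: differentiableM.
have dX m k : differentiable (fun x : 'rV[K]_n => x 0 k ^+ m : K) x.
  elim: m => [|m IH]; first by under eq_fun do rewrite expr0; apply: differentiable_cst.
  by under eq_fun do rewrite exprS; apply: dM => //; apply: differentiable_coord.
have dP (r : seq 'I_n) (m : 'I_n -> nat) :
    differentiable (fun x : 'rV[K]_n => \prod_(i <- r) x 0 i ^+ m i : K) x.
  elim: r => [|i r IHr]; first by under eq_fun do rewrite big_nil; apply: differentiable_cst.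
  by under eq_fun do rewrite big_cons; apply: dM.
have -> : (fun x : 'rV[K]_n => meval (fun k => x 0 k) P) =
   (fun x => \sum_(m <- msupp P) mcoeff m P * \prod_i x 0 i ^+ m i).
  by apply/funext => z; rewrite mevalE.
elim: (msupp P) => [|m s IH].
  by under eq_fun do rewrite big_nil; apply: differentiable_cst.
under eq_fun do rewrite big_cons.
by apply: differentiableD => //; apply: dM; first exact: differentiable_cst.
Qed.

Lemma differentiable_row (V : normedModType K) n (f : 'I_n -> V -> K) x :
  (forall k, differentiable (f k) x) -> differentiable (fun z => \row_k f k z) x.
Proof.
move=> df.
have -> : (fun z => \row_k f k z) = \sum_k (fun z => f k z *: delta_mx 0 k : 'rV[K]_n).
  apply/funext => z; rewrite fct_sumE [LHS]row_sum_delta.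
  by apply: eq_bigr => k _; rewrite mxE.
by apply: differentiable_sum => k; apply: differentiableZl.
Qed.

Section MatrixDerivative.
Variables (V : normedModType K) (x u : V).

Definition dermx k l (M : V -> 'M[K]_(k, l)) : 'M[K]_(k, l) :=
  \matrix_(i, j) 'D_u (fun z => M z i j : K) x.

Definition derivablemx k l (M : V -> 'M[K]_(k, l)) :=
  forall i j, derivable (fun z => M z i j : K) x u.

Lemma dermxM k l h (M : V -> 'M[K]_(k, l)) (N : V -> 'M[K]_(l, h)) :
  derivablemx M -> derivablemx N ->
  dermx (fun z => M z *m N z) = dermx M *m N x + M x *m dermx N.
Proof.
move=> dM dN; apply/matrixP => i j; rewrite !mxE.
have -> : (fun z => (M z *m N z) i j : K) = \sum_t (fun z => M z i t : K) * (fun z => N z t j).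
  by apply/funext => z; rewrite mxE fct_sumE.
rewrite derive_sum => [|t]; last exact: derivableM.
rewrite -big_split; apply: eq_bigr => t _ /=.
by rewrite deriveM // !mxE addrC; congr (_ + _); rewrite [LHS]mulrC.
Qed.

Lemma derivablemxM k l h (M : V -> 'M[K]_(k, l)) (N : V -> 'M[K]_(l, h)) :
  derivablemx M -> derivablemx N -> derivablemx (fun z => M z *m N z).
Proof.
move=> dM dN i j.
have -> : (fun z => (M z *m N z) i j : K) = \sum_t (fun z => M z i t : K) * (fun z => N z t j).
  by apply/funext => z; rewrite mxE fct_sumE.
by apply: derivable_sum => t; apply: derivableM.
Qed.

Lemma dermx_cst k l (A : 'M[K]_(k, l)) : dermx (fun=> A) = 0.
Proof. by apply/matrixP => i j; rewrite !mxE derive_cst. Qed.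

End MatrixDerivative.
End Calculus.

(** * The differential of a change of charts acting on block upper matrices *)

Section Jacobian.
Variables (K : numFieldType) (I : finType) (n a b : I -> nat).
Hypothesis hab : forall v, (a v <= b v <= n v)%N.
Local Notation F := (flag_atlas K hab).
Local Notation fchart := (@chart K F).
Implicit Types (g h : bases K n) (x y z u : 'rV[K]_(fdim n a b)).
Local Notation cc := (coord_change (X := F)).
Local Open Scope classical_set_scope.

Definition flag_pred (c : {v : I & ('I_(n v) * 'I_(n v))%type}) : bool :=
  (blk a b (tag c) (tagged c).1 < blk a b (tag c) (tagged c).2)%N.
Local Notation nil := (smx (P := flag_pred)).

(** The strictly block upper part [nil x] is linear in [x], so the derivative of [unip] along [u] is
    [nil u]. *)
Lemma unipE x v : unip x v = 1%:M + nil x v.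
Proof.
apply/matrixP => k l; rewrite !mxE /fentry; case: insubP => [c kl _|_]; last by rewrite addr0.
by rewrite /=; case: eqP kl => [->|]; rewrite ?ltnn ?add0r.
Qed.

Lemma blk_ltP v k l : (blk a b v k < blk a b v l)%N ->
  exists2 s, s = a v \/ s = b v & (k < s <= l)%N.
Proof.
have := hab v; rewrite /blk; have [ak|ka] := leqP (a v) k => ha kl.
  by exists (b v); [right | lia].
by exists (a v); [left | lia].
Qed.

Lemma block_ltn v s k l : s = a v \/ s = b v -> (k < s <= l)%N -> (blk a b v k < blk a b v l)%N.
Proof. by move=> hs; have := hab v; rewrite /blk; case: hs => ->; lia. Qed.

Lemma nil_le x v (k l : 'I_(n v)) : (blk a b v l <= blk a b v k)%N -> nil x v k l = 0.
Proof. by move=> h; rewrite smx_off // /flag_pred /= -leqNgt. Qed.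

Lemma derivable_unip (V : normedModType K) (t w : V) (f : V -> 'rV[K]_(fdim n a b)) v :
  differentiable f t -> derivablemx t w (fun s : V => unip (f s) v).
Proof.
move=> df k l; apply: diff_derivable.
have := polyfun_differentiable (f t) (@polyfun_unip K I n a b v k l).
by move=> /(differentiable_comp df).
Qed.

Lemma dermx_unip (V : normedModType K) (t w : V) (f : V -> 'rV[K]_(fdim n a b)) v :
  differentiable f t -> dermx t w (fun s : V => unip (f s) v) = nil ('D_w f t) v.
Proof.
move=> df; apply/matrixP => k l; rewrite !mxE /fentry.
under eq_fun do rewrite mxE /fentry.
case: insubP => [c _ _|_]; last exact: derive_cst.
exact: derive_coord.
Qed.

Lemma coord_change_differentiable g h x y : fchart g x = fchart h y ->
  (\forall z \near x, fchart h (coord_change (X := F) g h z) = fchart g z) /\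
  differentiable (coord_change (X := F) g h) x.
Proof.
move=> e; have [P [Q [hP hQ Qx PQ]]] := chart_glue e.
pose f z := \row_k (P k z / Q z).
have nQ : \forall z \near x, Q z != 0.
  exact: cvgr_neq0 (differentiable_continuous (polyfun_differentiable x hQ)) Qx.
have fE : {near x, f =1 coord_change (X := F) g h}.
  near=> z; apply/esym/coord_changeE; rewrite PQ //; near: z; exact: nQ.
split.
  near=> z; rewrite -(near fE z) // PQ //; near: z; exact: nQ.
apply: (near_eq_differentiable fE); apply: differentiable_row => k.
have dP := polyfun_differentiable x (hP k); have dQ := polyfun_differentiable x hQ.
apply: differentiableM => //; exact: differentiableV.
Unshelve. all: end_near. Qed.

Lemma invmx_adapted g x v : invmx (adapted g x v) = invmx (sval g v) *m invmx (unip x v).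
Proof. by rewrite invmx_mul ?unip_unit ?(svalP g v). Qed.

(** The derivative of [adapted g z v = T z *m adapted h (cc g h z) v] is multiplied on the right by
    [invmx (adapted g x v)] and read at a strictly block upper entry. *)
Lemma jacobian_nil g h x y u v (k l : 'I_(n v)) : fchart g x = fchart h y ->
  (blk a b v k < blk a b v l)%N ->
  (nil u v *m invmx (unip x v)) k l =
  (transmx g h x y v *m (nil (u *m 'J (cc g h) x) v *m invmx (unip y v)) *m transmx h g y x v) k l.
Proof.
move=> e /(blk_ltP)[s hs ksl]; have [ks sl] := andP ksl.
have [nchart dphi] := coord_change_differentiable e.
have phix : cc g h x = y by apply: coord_changeE.
pose T z := transmx g h z (cc g h z) v.
have AT : (fun z => adapted g z v) = (fun z => T z *m adapted h (cc g h z) v).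
  by apply/funext => z; rewrite /T /transmx mulmxKV ?adapted_unit.
have dBv : derivablemx x u (fun z => adapted h (cc g h z) v).
  apply: derivablemxM; first exact: derivable_unip.
  by move=> i j; apply: derivable_cst.
have dT : derivablemx x u T.
  apply: derivablemxM; first apply: derivablemxM.
  - exact: (@derivable_unip _ x u id).
  - by move=> i j; apply: derivable_cst.
  move=> i j; apply: diff_derivable.
  have := polyfun_differentiable (cc g h x) (@polyfun_invmx_adapted K I n a b h v i j).
  by move=> /(differentiable_comp dphi).
have dA : dermx x u (fun z => adapted g z v) = nil u v *m sval g v.
  rewrite /adapted dermxM; last by move=> i j; apply: derivable_cst.
    by rewrite dermx_cst mulmx0 addr0 (@dermx_unip _ x u id) ?derive_id.
  exact: (@derivable_unip _ x u id).
have dB : dermx x u (fun z => adapted h (cc g h z) v) = nil (u *m 'J (cc g h) x) v *m sval h v.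
  rewrite /adapted dermxM; last by move=> i j; apply: derivable_cst.
    by rewrite dermx_cst mulmx0 addr0 dermx_unip // deriveEjacobian.
  exact: derivable_unip.
have := dA; rewrite AT dermxM // phix dB.
move/(congr1 (fun M => M *m invmx (adapted g x v))).
rewrite [in RHS]invmx_adapted [in RHS]mulmxA mulmxK ?(svalP g v) // => <-.
rewrite mulmxDl mxE -[_ *m _ *m invmx _]mulmxA -/(transmx h g y x v).
(* Near [x] the two flags agree, so [T] stays block lower triangular and its derivative has the same
   zeros; multiplying by a block lower triangular matrix keeps them. *)
have -> : (dermx x u T *m transmx h g y x v) k l = 0.
  rewrite mxE big1 // => j _; have [sj|js] := leqP s j; last first.
    by rewrite (transmx_lower (esym e) hs) ?mulr0.
  rewrite mxE (near_eq_derive (g := cst 0)) ?derive_cst ?mul0r //.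
  near=> z; rewrite /T; apply: (@transmx_lower _ _ _ _ _ hab _ _ _ _ _ s) => //.
  by apply/esym; near: z.
rewrite add0r /T phix; congr (fun_of_matrix _ k l).
rewrite /transmx (invmx_adapted h) (invmx_adapted g) /adapted !mulmxA.
rewrite mulmxKV ?unip_unit //.
Unshelve. all: by end_near. Qed.

Lemma det_rmul_unip y : \det (rmulmx flag_pred (fun v => unip y v)) = 1.
Proof.
rewrite det_rmulmx big1 // => v _; rewrite big1 // => k _.
exact: det_minormx_unip.
Qed.

Lemma nil_rmul_unip u y v :
  nil (u *m rmulmx flag_pred (fun v => unip y v)) v = nil u v *m unip y v.
Proof.
apply: (@smxP _ _ _ _ _ _ (fun v => nil u v *m unip y v)) => [v' k l|c]; last exact: mul_rmulmx.
rewrite /flag_pred /= -leqNgt => lk; rewrite mxE big1 // => j _.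
have [jk|kj] := leqP (blk a b v' j) (blk a b v' k); first by rewrite nil_le // mul0r.
rewrite unip_lower; last by apply: leq_trans lk (ltnW kj).
by case: eqP => [jl|]; rewrite ?mulr0 //; move: kj; rewrite jl ltnNge lk.
Qed.

Lemma nil_rmul_unipV u y v :
  nil (u *m invmx (rmulmx flag_pred (fun v => unip y v))) v = nil u v *m invmx (unip y v).
Proof.
have uR : rmulmx flag_pred (fun v => unip y v) \in unitmx.
  by rewrite unitmxE det_rmul_unip unitr1.
by rewrite -[X in _ = nil X _ *m _](mulmxKV uR) nil_rmul_unip mulmxK ?unip_unit.
Qed.

(** The matrix form of [jacobian_nil]: the last two factors are conjugation by the transition matrix
    modulo block lower triangular matrices, and the [unip] factors have determinant 1. *)
Lemma jacobian_factor g h x y : fchart g x = fchart h y ->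
  invmx (rmulmx flag_pred (fun v => unip x v)) =
  'J (cc g h) x *m invmx (rmulmx flag_pred (fun v => unip y v)) *m
    rmulmx flag_pred (fun v => transmx h g y x v) *m
    lmulmx flag_pred (fun v => transmx g h x y v).
Proof.
move=> e; apply: eq_mulrV => u; rewrite !mulmxA; apply/rowP => i.
rewrite -(enum_valK i); move: (enum_val i) => c; rewrite mul_lmulmx.
rewrite -[LHS]smx_val nil_rmul_unipV.
have := valP c; case E : (val c) => [v [k l]] /= kl.
rewrite (jacobian_nil u e kl).
rewrite -nil_rmul_unipV; set w := u *m 'J _ x *m invmx _.
(* [Y] consists of the entries discarded by [rmulmx]. It vanishes on the pattern, and left
   multiplication by a block lower triangular matrix cannot bring it back there. *)
pose Y := nil w v *m transmx h g y x v -
  nil (w *m rmulmx flag_pred (fun v => transmx h g y x v)) v.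
apply/eqP; rewrite -subr_eq0; apply/eqP.
transitivity ((transmx g h x y v *m Y) k l).
  by rewrite mulmxBr [in RHS]mxE [X in _ = _ + X]mxE -[in LHS]mulmxA.
have [s hs /andP[ks sl]] := blk_ltP kl.
rewrite mxE big1 // => j _; have [sj|js] := leqP s j.
  by rewrite (transmx_lower e hs) ?mul0r.
have jl : flag_pred (existT (fun v => ('I_(n v) * 'I_(n v))%type) v (j, l)).
  by apply: (block_ltn hs); rewrite js.
have := mul_rmulmx w (fun v => transmx h g y x v) (Sub _ jl).
rewrite -smx_val /= => ej.
by rewrite [Y _ _]mxE [X in _ + X]mxE ej subrr mulr0.
Qed.

(** Rows of the first and middle blocks give the trailing minors of the inverse at [a] and [b], with
    exponents [a] and [b - a]. Columns of the middle and last blocks give the leading minors at [a]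
    and [b], with exponents [b - a] and [n - b]. *)
Lemma canonicalE g h x y : fchart g x = fchart h y ->
  canonical_bundle F g h x = \prod_v
    (chart_minor g h x v (a v) ^+ b v * chart_minor g h x v (b v) ^+ (n v - a v) /
       basis_ratio g h v ^+ b v).
Proof.
move=> e; have := congr1 determinant (jacobian_factor e).
rewrite !det_mulmx !det_inv !det_rmul_unip invr1 mulr1 -mulrA => /esym eJ.
rewrite /canonical_bundle.
have /(canRL (mulKf _)) := eJ.
have J0 : \det ('J (cc g h) x) != 0.
  by apply/eqP => J0; move/eqP: eJ; rewrite J0 mul0r eq_sym oner_eq0.
move=> /(_ J0); rewrite mulr1 => <-.
rewrite det_rmulmx det_lmulmx -big_split; apply: eq_bigr => v _ /=.
have [ha hb] : (a v = a v \/ a v = b v) /\ (b v = a v \/ b v = b v) by auto.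
have := hab v => /andP[abv bnv].
have r0 := basis_ratio_neq0 g h v.
have a0 := chart_minor_neq0 e ha; have b0 := chart_minor_neq0 e hb.
rewrite (eq_bigr (fun k : 'I_(n v) => if (k < a v)%N then \det (trailmx (a v) (transmx h g y x v))
   else if (k < b v)%N then \det (trailmx (b v) (transmx h g y x v)) else 1)); last first.
  move=> k _; rewrite /flag_pred /=.
  have [ka|ak] := ltnP k (a v).
    congr (\det _); apply/matrixP => i j; rewrite trailmxE mxE.
    by rewrite !(_ : forall i, (blk a b v k < blk a b v i)%N = (a v <= i)%N) // /blk => i'; lia.
  have [kb|bk] := ltnP k (b v).
    congr (\det _); apply/matrixP => i j; rewrite trailmxE mxE.
    by rewrite !(_ : forall i, (blk a b v k < blk a b v i)%N = (b v <= i)%N) // /blk => i'; lia.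
  by rewrite minormx0 ?det1 // => i /=; rewrite /blk; lia.
rewrite prod_ord_blocks ?hab //.
rewrite [X in _ * X](eq_bigr (fun k : 'I_(n v) => if (k < a v)%N then 1
   else if (k < b v)%N then \det (leadmx (a v) (transmx g h x y v)) else
    \det (leadmx (b v) (transmx g h x y v)))); last first.
  move=> l _; rewrite /flag_pred /=.
  have [la|al] := ltnP l (a v).
    by rewrite minormx0 ?det1 // => i /=; rewrite /blk; lia.
  have [lb|bl] := ltnP l (b v).
    congr (\det _); apply/matrixP => i j; rewrite leadmxE mxE.
    by rewrite !(_ : forall i, (blk a b v i < blk a b v l)%N = (i < a v)%N) // /blk => i'; lia.
  congr (\det _); apply/matrixP => i j; rewrite leadmxE mxE.
  by rewrite !(_ : forall i, (blk a b v i < blk a b v l)%N = (i < b v)%N) // /blk => i'; lia.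
rewrite prod_ord_blocks ?hab //.
rewrite (det_trailmx_trans (esym e) ha) (det_trailmx_trans (esym e) hb).
rewrite (chart_minorV e ha) (chart_minorV e hb) (basis_ratioV g h).
rewrite (det_leadmx_trans e ha) (det_leadmx_trans e hb) !expr1n !mul1r mulr1 !invrK.
move: (chart_minor _ _ _ _ _) (chart_minor _ _ _ _ _) (basis_ratio _ _ _) a0 b0 r0
  => A B r a0 b0 r0.
move: (a v) (b v) (n v) abv bnv => a' b' n' /subnKC <- /subnKC <-.
rewrite !addKn -addnA addKn !exprD !exprMn !exprVn.
by field; rewrite !expf_neq0.
Qed.
End Jacobian.

(** * Projective lines in the flag product *)

Lemma polyfun_line (K : numFieldType) n (f : 'rV[K]_n -> K) x y : polyfun f ->
  exists q : {poly K}, forall t, f (y + t *: (x - y)) = q.[t].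
Proof.
case=> P fP; exists (\sum_(m <- msupp P) (mcoeff m P)%:P *
  \prod_i ((y 0 i)%:P + (x 0 i - y 0 i) *: 'X) ^+ m i) => t.
rewrite fP mevalE horner_sum; apply: eq_bigr => m _.
rewrite hornerM hornerC horner_prod; congr (_ * _); apply: eq_bigr => i _.
by rewrite horner_exp !hornerE !mxE [t * _]mulrC.
Qed.

(** On the line through [x] and [y] the function is a univariate polynomial without roots, hence
    constant over an algebraically closed field. *)
Lemma polyfun_nonvanishing (K : numClosedFieldType) n (f : 'rV[K]_n -> K) :
  polyfun f -> (forall x, f x != 0) -> forall x y, f x = f y.
Proof.
move=> pf f0 x y; have [q qE] := polyfun_line x y pf.
have [sq|/closed_rootP[t]] := boolP (size q == 1%N); last first.
  by rewrite rootE -qE (negbTE (f0 _)).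
have /size_poly1P[c _ qc] := sq.
have := qE 1; have := qE 0; rewrite scale0r scale1r addr0 addrC subrK => -> ->.
by rewrite qc !hornerC.
Qed.

Section Exponents.
Variables (K : numFieldType) (I : finType) (n a b : I -> nat).
Hypothesis hab : forall v, (a v <= b v <= n v)%N.
Local Notation F := (flag_atlas K hab).
Local Notation fchart := (@chart K F).
Implicit Types (g h : bases K n) (x y z u : 'rV[K]_(fdim n a b)).

Definition minor_monomial (al be : I -> nat) g h x : K :=
  \prod_v (chart_minor g h x v (a v) ^+ al v * chart_minor g h x v (b v) ^+ be v).

Lemma minor_monomial_neq0 al be g h x y : fchart g x = fchart h y ->
  minor_monomial al be g h x != 0.
Proof.
move=> e; apply/prodf_neq0 => v _.
by rewrite mulf_neq0 // expf_neq0 // (chart_minor_neq0 e); auto.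
Qed.

(* The charts [swap_bases] and 1, which differ by exchanging two consecutive basis
   vectors at one vertex, parametrize a projective line in F on which one
   tautological bundle has degree -1 and all the others are trivial. *)
Section Swap.
Variables (v0 : I) (s0 : nat).
Hypotheses (s0_or : s0 = a v0 \/ s0 = b v0) (s0_gt0 : (0 < s0)%N) (s0_lt : (s0 < n v0)%N).

(** Indices start at 0: [s0.-1] is the last basis vector of the subspace of dimension [s0], and [s0]
    the first one outside it. *)
Definition swap v (k : nat) : nat :=
  if v == v0 then (if k == s0.-1 then s0 else if k == s0 then s0.-1 else k) else k.

Lemma swapK v k : swap v (swap v k) = k.
Proof. by rewrite /swap; case: (v == v0) => //; do !case: eqP; lia. Qed.

Lemma swap_lt v k : (k < n v)%N -> (swap v k < n v)%N.
Proof. by rewrite /swap; case: (v =P v0) => [->|//]; do !case: eqP; lia. Qed.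

Definition swapmx v : 'M[K]_(n v) := \matrix_(k, l) (swap v k == l)%:R.

Definition edgemx v : 'M[K]_(n v) :=
  \matrix_(k, l) [&& v == v0, k == s0.-1 :> nat & l == s0 :> nat]%:R.

Lemma mul_swapmx v (A : 'M[K]_(n v)) k l :
  (swapmx v *m A) k l = A (Ordinal (swap_lt (ltn_ord k))) l.
Proof.
rewrite mxE (bigD1 (Ordinal (swap_lt (ltn_ord k)))) //= big1 ?addr0 => [|j jk].
  by rewrite mxE eqxx mul1r.
rewrite mxE; case: eqP => [e|]; last by rewrite mul0r.
by case/eqP: jk; apply: val_inj.
Qed.

Lemma swapmx_unit v : swapmx v \in unitmx.
Proof.
suff : swapmx v *m swapmx v = 1%:M by case/mulmx1_unit.
apply/matrixP => k l; rewrite mul_swapmx !mxE /= swapK.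
by [].
Qed.

Lemma edgemx_sqr v : edgemx v *m edgemx v = 0.
Proof.
apply/matrixP => k l; rewrite !mxE big1 // => j _; rewrite !mxE.
case: and3P => [[_ _ /eqP js]|_]; last by rewrite mul0r.
by case: and3P => [[_ /eqP js' _]|_]; [lia | rewrite mulr0].
Qed.

Lemma mul_edge_swap v k l : (edgemx v *m swapmx v) k l =
  [&& v == v0, k == s0.-1 :> nat & l == s0.-1 :> nat]%:R.
Proof.
rewrite mxE; have [vv|/negbTE ne] := boolP (v == v0) => /=; last first.
  by rewrite big1 // => j _; rewrite mxE ne mul0r.
have s0v : (s0 < n v)%N by rewrite (eqP vv).
rewrite (bigD1 (Ordinal s0v)) //= big1 ?addr0 => [|j js].
  rewrite !mxE vv eqxx /= andbT /swap vv eqxx.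
  have -> : (s0 == s0.-1) = false by apply/negbTE/eqP; lia.
  by rewrite [s0.-1 == _]eq_sym; case: (_ == _); rewrite ?mul1r ?mul0r.
rewrite mxE; case: and3P => [[_ _ /eqP e']|_]; last by rewrite mul0r.
by case/eqP: js; apply: val_inj.
Qed.

Definition swap_bases : bases K n := exist _ swapmx swapmx_unit.

Lemma one_bases_subproof v : (1%:M : 'M[K]_(n v)) \in unitmx.
Proof. exact: unitmx1. Qed.
Definition one_bases : bases K n := exist _ (fun v => 1%:M) one_bases_subproof.

Lemma edge_blk : (blk a b v0 s0.-1 < blk a b v0 s0)%N.
Proof. by apply: (block_ltn hab s0_or); lia. Qed.

Definition edge_pt (t : K) : 'rV[K]_(fdim n a b) :=
  \row_i let c := val (enum_val i : fcoord n a b) in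
    t * edgemx (tag c) (tagged c).1 (tagged c).2.

Lemma unip_edge t v : unip (edge_pt t) v = 1%:M + t *: edgemx v.
Proof.
rewrite unipE; congr (_ + _).
apply: (@smxP _ _ _ _ _ _ (fun v => t *: edgemx v)) => [v' k l|c]; last first.
  by rewrite mxE enum_rankK [RHS]mxE.
rewrite /flag_pred /= !mxE => hN.
case: and3P => [[/eqP e /eqP ks /eqP ls]|_]; last by rewrite mulr0.
by move: hN; rewrite ks ls (congr1 (blk a b) e) edge_blk.
Qed.

(** The vectors [e_s0 + t e_(s0-1)] and [e_(s0-1) + t^-1 e_s0] are proportional, so both charts give
    the same flag. *)
Lemma edge_chart t : t != 0 -> fchart swap_bases (edge_pt t) = fchart one_bases (edge_pt t^-1).
Proof.
move=> t0; apply: transmx_chart => v s hs.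
(* As [edgemx] squares to 0, the inverse of [1 + t^-1 E] is [1 - t^-1 E]. *)
have -> : transmx swap_bases one_bases (edge_pt t) (edge_pt t^-1) v =
    (1%:M + t *: edgemx v) *m swapmx v *m (1%:M - t^-1 *: edgemx v).
  apply: (can_inj (mulmxK (adapted_unit one_bases (edge_pt t^-1) v))).
  rewrite /transmx mulmxKV ?adapted_unit // /adapted !unip_edge /= mulmx1 -[RHS]mulmxA.
  rewrite mulmxDr mulmx1 mulmxBl mul1mx -!scalemxAl -scalemxAr edgemx_sqr !scaler0.
  by rewrite subr0 subrK mulmx1.
move=> k l ks sl; rewrite mulmxBr mulmx1 -scalemxAr mulmxDl mul1mx -scalemxAl mulmxDl -scalemxAl.
rewrite -mulmxA.
have EsE : (edgemx v *m (swapmx v *m edgemx v)) k l = edgemx v k l.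
  have [vv|/negbTE ne] := boolP (v == v0); last first.
    by rewrite mxE big1 ?mxE ?ne // => j _; rewrite mxE ne mul0r.
  have s0v : (s0.-1 < n v)%N by rewrite (eqP vv); lia.
  rewrite mulmxA mxE (bigD1 (Ordinal s0v)) //= big1 ?addr0 => [|j js].
    by rewrite mul_edge_swap !mxE vv !eqxx /= andbT -natrM mulnb.
  rewrite mul_edge_swap; case: and3P => [[_ _ /eqP e']|_]; last by rewrite mul0r.
  by case/eqP: js; apply: val_inj.
have TE (A B C D : 'M[K]_(n v)) c d :
  (A + c *: B - d *: (C + c *: D)) k l = A k l + c * B k l - d * (C k l + c * D k l).
  by rewrite !mxE.
rewrite TE EsE mul_edge_swap mul_swapmx !mxE /=.
rewrite mulrDr mulrA mulVf // mul1r /swap.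
have kl : (k < l)%N := leq_trans ks sl.
case: (v == v0) => /=; last first.
  have -> : (k == l :> nat) = false by apply/negbTE/eqP; lia.
  by rewrite !mulr0 !addr0 subrr.
have -> : (k == s0.-1 :> nat) && (l == s0.-1 :> nat) = false by lia.
have [e1|n1] := eqVneq (nat_of_ord k) s0.-1.
  have -> : (s0 == s0.-1) = false by apply/negbTE/eqP; lia.
  by rewrite /= !mulr0 addr0 add0r [s0 == _]eq_sym subrr.
rewrite /= !mulr0 !addr0.
have [e2|n2] := eqVneq (nat_of_ord k) s0.
  have -> : (s0.-1 == l :> nat) = false by apply/negbTE/eqP; lia.
  have -> : (l == s0 :> nat) = false by apply/negbTE/eqP; lia.
  by rewrite andbF mulr0 subrr.
have -> : (k == l :> nat) = false by apply/negbTE/eqP; lia.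
by rewrite (negbTE n1) mulr0 subrr.
Qed.

Definition minor_factor (t : K) v s : K := if (v == v0) && (s == s0) then t else 1.

Lemma block_lower_edge t v s : ~~ ((v == v0) && (s == s0)) -> block_lower s (1%:M + t *: edgemx v).
Proof.
move=> h k l ks sl; rewrite !mxE.
have -> : (k == l) = false by apply/negbTE/eqP => e; move: sl; rewrite -e leqNgt ks.
case: and3P => [[vv /eqP ek /eqP el]|_]; last by rewrite mulr0 addr0.
by move: h; rewrite vv /=; lia.
Qed.

(** Away from [(v0, s0)] the matrix [1 + t E] is block lower with leading minor 1, so [t] drops out.
    At [(v0, s0)] truncation cuts off the swapped entry and leaves a diagonal matrix with [t] at
    [s0.-1] and 1 elsewhere. *)
Lemma chart_minor_edge t v s : chart_minor swap_bases one_bases (edge_pt t) v s =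
  minor_factor t v s * chart_minor swap_bases one_bases (edge_pt 1) v s.
Proof.
have key r : ~~ ((v == v0) && (s == s0)) ->
    chart_minor swap_bases one_bases (edge_pt r) v s = \det (leadmx s (swapmx v)).
  move=> h; rewrite /chart_minor /adapted /= invmx1 mulmx1 unip_edge.
  rewrite leadmxM; last exact: block_lower_edge.
  by rewrite det_mulmx -unip_edge [X in X * _]det_minormx_unip mul1r.
have [h|h] := boolP ((v == v0) && (s == s0));
  last by rewrite !key // /minor_factor (negbTE h) mul1r.
suff key' r : chart_minor swap_bases one_bases (edge_pt r) v s = r.
  by rewrite !key' /minor_factor h mulr1.
case/andP: h => vv /eqP ->.
have s0v : (s0.-1 < n v)%N by rewrite (eqP vv); lia.
rewrite /chart_minor /adapted /= invmx1 mulmx1 unip_edge mulmxDl mul1mx -scalemxAl.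
have dE (k l : 'I_(n v)) : leadmx s0 (swapmx v + r *: (edgemx v *m swapmx v)) k l =
    if k == s0.-1 :> nat then r * (l == s0.-1 :> nat)%:R else (k == l)%:R.
  have SE (A B : 'M[K]_(n v)) : (A + r *: B) k l = A k l + r * B k l by rewrite !mxE.
  rewrite leadmxE SE mul_edge_swap mxE /swap vv /=.
  have [ek|nk] := eqVneq (nat_of_ord k) s0.-1.
    have -> : (k < s0)%N by lia.
    have [ls|sl] := ltnP l s0; rewrite /=.
      have -> : (s0 == l :> nat) = false by apply/negbTE/eqP; lia.
      by rewrite add0r.
    have -> : (l == s0.-1 :> nat) = false by apply/negbTE/eqP; lia.
    by rewrite mulr0; case: eqP => // e; move: sl; rewrite -e; lia.
  rewrite mulr0 addr0; have [ks|//] := ltnP k s0.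
  by rewrite (ltn_eqF ks) if_same.
have trig (k l : 'I_(n v)) : k != l ->
    leadmx s0 (swapmx v + r *: (edgemx v *m swapmx v)) k l = 0.
  move=> kl; rewrite dE (negbTE kl); case: eqP => // ek; case: eqP => [el|]; last by rewrite mulr0.
  by case/eqP: kl; apply: val_inj; rewrite /= ek el.
rewrite det_trig; last first.
  apply/is_trig_mxP => k l kl; apply: trig; apply: contraTneq kl => ->.
  by rewrite ltnn.
rewrite (bigD1 (Ordinal s0v)) //= dE /= !eqxx mulr1 big1 ?mulr1 // => k ks; rewrite dE eqxx.
by case: eqP => // e; case/eqP: ks; apply: val_inj.
Qed.

Lemma minor_monomial_edge al be t : (a v0 < b v0)%N ->
  minor_monomial al be swap_bases one_bases (edge_pt t) =
  t ^+ (if s0 == a v0 then al v0 else be v0) *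
  minor_monomial al be swap_bases one_bases (edge_pt 1).
Proof.
(* As [a v0 < b v0], exactly one of the two ranks at [v0] equals [s0], so a single exponent is
   detected. *)
move=> ab0; have -> : t ^+ (if s0 == a v0 then al v0 else be v0) =
    \prod_v (minor_factor t v (a v) ^+ al v * minor_factor t v (b v) ^+ be v).
  rewrite (bigD1 v0) //= big1 ?mulr1 => [|v /negbTE ne]; last first.
    by rewrite /minor_factor ne !expr1n mulr1.
  rewrite /minor_factor eqxx /= ![_ == s0]eq_sym; case: s0_or => ->; rewrite eqxx.
    by rewrite (ltn_eqF ab0) expr1n mulr1.
  by rewrite (gtn_eqF ab0) expr1n mul1r.
rewrite -big_split; apply: eq_bigr => v _ /=.
rewrite ![chart_minor _ _ (edge_pt t) _ _]chart_minor_edge !exprMn -!mulrA; congr (_ * _).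
by rewrite mulrCA.
Qed.

End Swap.
End Exponents.

(** * Comparison of the exponents *)

Section Crepancy.
Variables (K : numFieldType) (m : nat) (d : nat -> nat) (a b : 'I_m.*2.+1 -> nat).
Hypothesis hab : forall v, (a v <= b v <= vdim d v)%N.
Local Notation F := (flag_atlas K hab).
Local Notation fchart := (@chart K F).
Implicit Types (g h : bases K (@vdim m d)) (x y : 'rV[K]_(fdim (@vdim m d) a b)).

(* The exponent in det W of det (U_2) (for [c = true]) or det (U_1) at v. *)
Definition W_exponent (c : bool) (v : 'I_m.*2.+1) : nat :=
  (\sum_(e : arrow m | (target e == v) && (e.2 == c))
      (vdim d (source e) - part_dim a b e (source e)) +
   \sum_(e : arrow m | (source e == v) && (e.2 == c)) part_dim a b e (target e))%N.

(** The arrows are regrouped by the vertex [f e], and their kind [e.2] decides between U_2 and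
    U_1. *)
Lemma prod_arrow_minor (f : arrow m -> 'I_m.*2.+1) (N : arrow m -> nat) g h x :
  \prod_e chart_minor g h x (f e) (part_dim a b e (f e)) ^+ N e =
  minor_monomial (fun v => \sum_(e | (f e == v) && (e.2 == false)) N e)%N
    (fun v => \sum_(e | (f e == v) && (e.2 == true)) N e)%N g h x.
Proof.
rewrite (partition_big f xpredT) //=; apply: eq_bigr => v _.
rewrite (bigID (fun e : arrow m => e.2)) /= mulrC; congr (_ * _).
  rewrite (big_morph _ (exprD _) (expr0 _)); apply: eq_big => [e|e /andP[/eqP -> /negbTE e2]].
    by case: e.2.
  by rewrite /part_dim e2.
rewrite (big_morph _ (exprD _) (expr0 _)); apply: eq_big => [e|e /andP[/eqP -> e2]].
  by case: e.2.
by rewrite /part_dim e2.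
Qed.

(** [W_ratio] and [F_ratio] collect the powers of the determinants of the transition matrices. They
    depend on the bases only and are multiplicative along three charts. *)
Definition W_ratio g h : K :=
  \prod_(e : arrow m) basis_ratio g h (source e) ^+ part_dim a b e (target e).
Definition F_ratio g h : K := \prod_v basis_ratio g h v ^+ b v.

Lemma W_ratio_neq0 g h : W_ratio g h != 0.
Proof. by apply/prodf_neq0 => e _; rewrite expf_neq0 // basis_ratio_neq0. Qed.

Lemma F_ratio_neq0 g h : F_ratio g h != 0.
Proof. by apply/prodf_neq0 => e _; rewrite expf_neq0 // basis_ratio_neq0. Qed.

Lemma det_W_monomial g h x y : fchart g x = fchart h y ->
  det_bundle (W_bundle K hab) g h x =
  minor_monomial (W_exponent false) (W_exponent true) g h x / W_ratio g h.
Proof.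
move=> e; rewrite (det_WE e) big_split /=.
under [X in _ * X]eq_bigr do rewrite expr_div_n.
rewrite prodf_div mulrA; congr (_ / _).
rewrite (@prod_arrow_minor (@target m)) (@prod_arrow_minor (@source m)).
rewrite -big_split; apply: eq_bigr => v _ /=.
by rewrite /W_exponent !exprD mulrACA.
Qed.

Lemma canonical_monomial g h x y : fchart g x = fchart h y ->
  canonical_bundle F g h x =
  minor_monomial b (fun v => vdim d v - a v)%N g h x / F_ratio g h.
Proof. by move=> e; rewrite (canonicalE e) prodf_div. Qed.

(** A subspace of dimension 0 has a trivial determinant bundle, so its exponent is unconstrained. *)
Definition exponents_match : Prop := forall v,
  (a v = 0%N \/ W_exponent false v = b v) /\
  (b v = 0%N \/ W_exponent true v = (vdim d v - a v)%N).

Lemma crepant_of_exponents : exponents_match ->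
  lb_iso (det_bundle (W_bundle K hab)) (canonical_bundle F).
Proof.
move=> hE.
have cm0 g h x v : chart_minor g h x v 0 = 1 by rewrite /chart_minor /leadmx minormx0 ?det1.
have XE g h x : minor_monomial (W_exponent false) (W_exponent true) g h x =
    minor_monomial b (fun v => vdim d v - a v)%N g h x.
  apply: eq_bigr => v _; have [ha hb] := hE v; congr (_ * _).
    by case: ha => [->|->] //; rewrite cm0 !expr1n.
  by case: hb => [->|->] //; rewrite cm0 !expr1n.
pose one : bases K (@vdim m d) := one_bases K (@vdim m d).
(* Comparison with the fixed chart [one] writes the cocycle [F_ratio / W_ratio] as a coboundary of
   constants. *)
exists (fun g _ => F_ratio g one / W_ratio g one); split.
- by move=> g; apply: polyfun_cst.
- by move=> g _; rewrite mulf_neq0 ?invr_eq0 ?W_ratio_neq0 ?F_ratio_neq0.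
move=> g h x y e; rewrite (det_W_monomial e) (canonical_monomial e) XE.
have rM g' h' k v : basis_ratio g' k v = basis_ratio g' h' v * basis_ratio h' k v.
  by rewrite /basis_ratio mulrA mulfVK // -unitfE -unitmxE (svalP h').
have -> : F_ratio g one = F_ratio g h * F_ratio h one.
  by rewrite /F_ratio -big_split; apply: eq_bigr => v _; rewrite /= -exprMn -rM.
have -> : W_ratio g one = W_ratio g h * W_ratio h one.
  by rewrite /W_ratio -big_split; apply: eq_bigr => v _; rewrite /= -exprMn -rM.
have := F_ratio_neq0 g h; have := W_ratio_neq0 g h; have := W_ratio_neq0 h one.
move: (F_ratio _ _) (F_ratio _ _) (W_ratio _ _) (W_ratio _ _) (minor_monomial _ _ _ _ _)
  => A B C D X d0 c0 a0.
by field; rewrite ?a0 ?c0 ?d0.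
Qed.

End Crepancy.

Lemma exponents_of_crepant (K : numClosedFieldType) m d (a b : 'I_m.*2.+1 -> nat)
    (hab : forall v, (a v <= b v <= vdim d v)%N) :
  (forall v, (a v = 0%N \/ (a v < b v)%N) /\ (b v = 0%N \/ (b v < vdim d v)%N)) ->
  lb_iso (det_bundle (W_bundle K hab)) (canonical_bundle (flag_atlas K hab)) ->
  exponents_match d a b.
Proof.
move=> hgen [f [pf f0 fE]] v.
have key s (so : s = a v \/ s = b v) : (0 < s)%N ->
    (if s == a v then b v else vdim d v - a v)%N =
    (if s == a v then W_exponent d a b false v else W_exponent d a b true v).
  move=> s0; have [ha hb] := hgen v.
  have ab0 : (a v < b v)%N by have := hab v; case: ha hb so; lia.
  have sn : (s < vdim d v)%N by have := hab v; case: hb; case: so; lia.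
  pose g := swap_bases K so s0 sn; pose h := one_bases K (@vdim m d).
  pose x := @edge_pt K _ (@vdim m d) a b v s.
  have chE (t : K) : t != 0 ->
      @chart K (flag_atlas K hab) g (x t) = @chart K (flag_atlas K hab) h (x t^-1).
    by apply: edge_chart.
  (* The local functions of the isomorphism are constant, so their values at [x 1] serve for every
     [t]. *)
  have H t : t != 0 ->
      f g (x 1) * (minor_monomial b (fun v => vdim d v - a v)%N g h (x t) / F_ratio b g h) =
      minor_monomial (W_exponent d a b false) (W_exponent d a b true) g h (x t) /
        W_ratio a b g h * f h (x 1).
    move=> t0; have := fE _ _ _ _ (chE t t0).
    rewrite (det_W_monomial (chE t t0)) (canonical_monomial (chE t t0)).
    rewrite (polyfun_nonvanishing (pf g) (f0 g) _ (x 1)).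
    by rewrite (polyfun_nonvanishing (pf h) (f0 h) _ (x 1)).
  have two0 : (2 : K) != 0 by rewrite pnatr_eq0.
  (* Comparing the relations at [t = 2] and [t = 1] equates two powers of 2, hence their
     exponents. *)
  have := H 2 two0; rewrite !(minor_monomial_edge hab so s0 sn _ _ 2 ab0) -!mulrA.
  rewrite [f _ _ * _]mulrCA (H 1 (oner_neq0 _)) -mulrA.
  move/(mulIf _) => /(_ _)/eqP; rewrite -!natrX eqr_nat eqn_exp2l // => h2.
  have X0 := @minor_monomial_neq0 _ _ _ _ _ hab
    (W_exponent d a b false) (W_exponent d a b true) _ _ _ _ (chE 1 (oner_neq0 _)).
  have := h2 _; case: ifP => _ h3; apply/eqP/h3;
    by rewrite mulf_neq0 // mulf_neq0 ?invr_eq0 ?W_ratio_neq0 ?f0.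
split.
  have [->|a0] := posnP (a v); [by left | right].
  by have := key (a v) (or_introl erefl) a0; rewrite eqxx => ->.
have [->|b0] := posnP (b v); [by left | right].
have := key (b v) (or_intror erefl) b0; have [/eqP ba|_ -> //] := boolP (b v == a v).
by have [ha _] := hgen v; move: ha; rewrite ba; lia.
Qed.

(** * Exponents read off the quiver *)

Section Weights.
Variables (m : nat) (d : nat -> nat) (a b : 'I_m.*2.+1 -> nat).

(** A sink is the target of exactly one arrow of each kind and the source of none. *)
Lemma W_exponent_target (k : 'I_m) c : W_exponent d a b c (target (k, c)) =
  (vdim d (source (k, c)) - part_dim a b (k, c) (source (k, c)))%N.
Proof.
rewrite /W_exponent [X in (_ + X)%N]big1 => [|e /andP[/eqP/(congr1 val)/= + _]]; last first.
  by case: e.2; lia.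
rewrite addn0 (big_pred1 (k, c)) // => -[k' c'] /=.
apply/andP/eqP => [[/eqP/(congr1 val)/= kk /eqP ->]|[-> ->]]; last by rewrite !eqxx.
by congr (_, _); apply: val_inj => /=; lia.
Qed.

(** No arrow ends at this vertex, and [(k, c)] is the only arrow of kind [c] that starts there. *)
Lemma W_exponent_source (k : 'I_m) c : W_exponent d a b c (source (k, c)) =
  part_dim a b (k, c) (target (k, c)).
Proof.
rewrite /W_exponent [X in (X + _)%N]big1 => [|e /andP[/eqP/(congr1 val)/= + _]]; last first.
  by case: c; lia.
rewrite add0n (big_pred1 (k, c)) // => -[k' c'] /=.
apply/andP/eqP => [[/eqP/(congr1 val)/= kk /eqP cc]|[-> ->]]; last by rewrite !eqxx.
by move: kk; rewrite cc; clear cc; case: c => kk; congr (_, _); apply: val_inj => /=; lia.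
Qed.

End Weights.

(** * From matching exponents to the numerical conditions *)

Theorem proposition3p19 (R : realType) (m : nat) (d r p q : nat -> nat)
    (m_gt0 : (0 < m)%N)
    (orbit_nonempty : exists phi : rep R[i] m d, orbit_set r p q phi)
    (hF : strict_flags m d r p q)
    (hp : forall i, (1 <= i <= m)%N -> p i <> r i.*2.-1 /\ p i <> r i.*2)
    (hq : forall j, (1 <= j < m)%N ->
      (q j)%:Z <> (d j.*2.+1)%:Z - (r j.*2.+1)%:Z /\
      (q j)%:Z <> (d j.*2.+1)%:Z - (r j.*2)%:Z) :
  crepant R[i] hF <->
  [/\ d 1%N = d m.*2.+1,
      forall i, (1 <= i <= m)%N -> p i = d 1%N,
      forall i, (1 <= i < m)%N -> (q i)%:Z = (d i.*2.+1)%:Z - (d 1%N)%:Z &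
      forall i, (1 <= i <= m.*2.-1)%N ->
        (r i)%:Z = (d i.+1)%:Z - (r i.+1)%:Z].
Proof.
have [h1 h2 h3] := hF.
pose a (v : 'I_m.*2.+1) := taut1 m r q v.+1; pose b (v : 'I_m.*2.+1) := taut2 m d r p v.+1.
pose T k c : 'I_m.*2.+1 := target (k, c); pose S k c : 'I_m.*2.+1 := source (k, c).
have aT (k : 'I_m) c : a (T k c) = r k.*2.+2.
  by rewrite /a /taut1 /= odd_double.
have bT (k : 'I_m) c : b (T k c) = p k.+1.
  by rewrite /b /taut2 /= odd_double /= doubleK.
have vT (k : 'I_m) c : vdim d (T k c) = d k.*2.+2 by [].
have aS (k : 'I_m) : a (S k true) = if k == 0%N :> nat then 0%N else q k.
  have km := ltn_ord k; rewrite /a /taut1 /= odd_double /= uphalf_double.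
  have -> : (k.*2.+1 == 1%N) = (k == 0%N :> nat) by lia.
  have -> : (k.*2.+1 == m.*2.+1) = false by lia.
  by rewrite orbF.
have bS (k : 'I_m) : b (S k true) = (d k.*2.+1 - r k.*2.+1)%N.
  have km := ltn_ord k; rewrite /b /taut2 /= odd_double /=.
  by have -> : (k.*2.+1 == m.*2.+1) = false by lia.
have aS' (k : 'I_m) : a (S k false) = if k.+1 == m then 0%N else q k.+1.
  rewrite /a /taut1 /= odd_double /= uphalf_double.
  by have -> : (k.*2.+3 == m.*2.+1) = (k.+1 == m) by lia.
have bS' (k : 'I_m) : b (S k false) = if k.+1 == m then 0%N else (d k.*2.+3 - r k.*2.+3)%N.
  rewrite /b /taut2 /= odd_double /=.
  by have -> : (k.*2.+3 == m.*2.+1) = (k.+1 == m) by lia.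
have s2 (k : 'I_m) : [/\ (0 < r k.*2.+2)%N, (r k.*2.+2 < p k.+1)%N & (p k.+1 < d k.*2.+2)%N].
  by have := h2 k.+1; rewrite doubleS ltn_ord; apply.
have s3 (k : nat) : (k.+1 < m)%N -> [/\ (0 < q k.+1)%N, (q k.+1 < d k.*2.+3 - r k.*2.+3)%N &
            (d k.*2.+3 - r k.*2.+3 < d k.*2.+3)%N].
  by move=> km; have := h3 k.+1; rewrite doubleS km; apply.
(* The vertices are the sinks, the sources [s_1, s_3, ..., s_(2m-1)], and the last source
   [s_(2m+1)]. *)
have cases v : (exists k c, v = T k c) \/ (exists k, v = S k true) \/
    (exists2 k : 'I_m, k.+1 = m & v = S k false).
  have vm := ltn_ord v; have ev := odd_double_half v; case: (boolP (odd v)) ev => _ /= ev.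
    have km : (v./2 < m)%N by lia.
    by left; exists (Ordinal km), true; apply: val_inj => /=; lia.
  right; have [km|km] := ltnP v./2 m.
    by left; exists (Ordinal km); apply: val_inj => /=; lia.
  have km' : (v./2.-1 < m)%N by lia.
  by right; exists (Ordinal km'); [move=> /=; lia | apply: val_inj => /=; lia].
(* Subtraction on [nat] truncates; strictness makes [d - r] a genuine difference at the sources. *)
have strict_r (k : 'I_m) : (r k.*2.+1 < d k.*2.+1)%N.
  case: (posnP k) => [->|k0]; first by move: h1; rewrite double0; lia.
  have := s3 k.-1; rewrite -doubleS prednK // => /(_ (ltn_ord k)).
  by case; lia.
(* Only U_1 is zero at [s_1], both subspaces are zero at [s_(2m+1)], and all other flags are
   strict. *)
have exE : crepant R[i] hF <-> exponents_match d a b.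
  split; last exact: (@crepant_of_exponents _ _ _ a b (taut_le hF)).
  apply: (@exponents_of_crepant R[i] _ _ a b (taut_le hF)) => v.
  case: (cases v) => [[k [c ->]]|[[k ->]|[k km ->]]].
  - by have := s2 k; rewrite aT bT vT => -[*]; split; right.
  - have := ltn_ord k; rewrite aS bS /vdim /=; case: eqP => [->|k0] km.
      by split; [left | right; case/andP: h1].
    have := s3 k.-1; rewrite -doubleS prednK; last lia.
    by move=> /(_ km)[*]; split; right.
  by rewrite aS' bS' km eqxx; split; left.
rewrite exE; split=> [hE|[g1 g2 g3 g4] v].
  (* [e1] and [e2] come from U_2 and U_1 at the sinks, [e3] and [e4] from U_2 and U_1 at the
     sources. *)
  have e1 (k : 'I_m) : r k.*2.+1 = (d k.*2.+2 - r k.*2.+2)%N.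
    have [_] := hE (T k true); rewrite bT aT vT W_exponent_target /part_dim /=.
    by rewrite -/(S k true) bS /vdim /=; case: (s2 k); have := strict_r k; lia.
  have e2 (k : 'I_m) : (d k.*2.+3 - a (S k false))%N = p k.+1.
    have [+ _] := hE (T k false); rewrite bT aT W_exponent_target /part_dim /=.
    by rewrite -/(S k false) /vdim /=; case: (s2 k); lia.
  have e3 (k : 'I_m) : p k.+1 = (d k.*2.+1 - a (S k true))%N.
    have [_] := hE (S k true); rewrite bS W_exponent_source /part_dim /=.
    by rewrite -/(T k true) bT /vdim /=; have := strict_r k; lia.
  have e4 (k : 'I_m) : (k.+1 < m)%N -> r k.*2.+2 = (d k.*2.+3 - r k.*2.+3)%N.
    move=> km; have [+ _] := hE (S k false); rewrite aS' bS' W_exponent_source /part_dim /=.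
    by rewrite -/(T k false) aT ltn_eqF //; case: (s3 k km); lia.
  (* Both [e2] at [k] and [e3] at [k.+1] involve [d_(2k+3) - q_(k+1)], so consecutive entries of [p]
     agree; the first is [d_1] because U_1 is zero at [s_1]. *)
  have e5 k (km : (k < m)%N) : p k.+1 = d 1%N.
    elim: k km => [|k IH] km; first by rewrite (e3 (Ordinal km)) aS /= subn0.
    have km' : (k < m)%N by lia.
    rewrite (e3 (Ordinal km)) aS -(IH km') -(e2 (Ordinal km')) aS' /=.
    by rewrite (ltn_eqF km).
  split.
  - have km : (m.-1 < m)%N by lia.
    rewrite -(e5 _ km) -(e2 (Ordinal km)) aS' /= prednK // eqxx subn0.
    by congr (d _); lia.
  - by move=> [|i] // im; apply: e5.
  - move=> [|i] // im; have km : (i < m)%N by lia.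
    have := e2 (Ordinal km); rewrite aS' /= e5 // doubleS ltn_eqF //.
    by case: (s3 i im); lia.
  (* Odd indices follow from [e1], even ones from [e4]. *)
  move=> i im; have ei := odd_double_half i; case: (boolP (odd i)) ei => _ /= ei.
    have km : (i./2 < m)%N by lia.
    have := e1 (Ordinal km); have := s2 (Ordinal km); rewrite /=.
    have <- : i = i./2.*2.+1 by lia.
    by case; lia.
  have km : (i./2.-1 < m)%N by lia.
  have km' : (i./2.-1.+1 < m)%N by lia.
  have := e4 (Ordinal km) km'; have := s3 _ km'.
  have <- : i = i./2.-1.*2.+2 by lia.
  by case; lia.
case: (cases v) => [[k [c ->]]|[[k ->]|[k km ->]]].
- split; right.
    (* The sink does not depend on [c], so the kind is chosen to be that of the exponent at hand. *)
    have -> : T k c = T k false by apply: val_inj.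
    rewrite W_exponent_target bT /part_dim /= -/(S k false) aS' /vdim /= g2 ?ltn_ord //.
    case: eqP => [km|km]; first by rewrite subn0 g1; congr (d _); lia.
    have km' : (k.+1 < m)%N by have := ltn_ord k; lia.
    by have := g3 k.+1 km'; rewrite doubleS; case: (s3 k km'); lia.
  have -> : T k c = T k true by apply: val_inj.
  rewrite W_exponent_target aT vT /part_dim /= -/(S k true) bS /vdim /=.
  have := g4 k.*2.+1; have := strict_r k; case: (s2 k); have := ltn_ord k; lia.
- split.
    rewrite aS; case: eqP => k0; [by left | right].
    have km := ltn_ord k; have k'm : (k.-1 < m)%N by lia.
    have kk : k.-1.+1 = k by lia.
    (* The exponent of U_1 at [s_(2k+1)] is read on the other arrow starting there, [a_(2k)]. *)
    rewrite bS; have -> : S k true = S (Ordinal k'm) false by apply: val_inj => /=; lia.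
    rewrite W_exponent_source /part_dim /= -/(T _ false) aT /= -doubleS kk.
    have := g4 k.*2; have := strict_r k; lia.
  right; rewrite aS W_exponent_source /part_dim /= -/(T k true) bT g2 ?ltn_ord // /vdim /=.
  case: eqP => [->|k0]; first by rewrite subn0.
  have km := ltn_ord k; have k1m : (1 <= k < m)%N by lia.
  by have := g3 k k1m; have := s3 k.-1; rewrite -doubleS prednK; [move=> /(_ km)[]; lia | lia].
by rewrite aS' bS' km eqxx; split; left.
Qed.
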